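(* Let $(M,g)$ be a complete Riemannian manifold, let $\ell>0$, and let $\gamma:[0,\mathcal{L}(\gamma)]\to M$ be a regular tractrix, parametrized by arc length $s$, with pole length $\ell$, poles $\lambda_s$, and tractor $\eta$. Then $$\mathcal{L}(\eta)-\mathcal{L}(\gamma)\;\geq\;\mathcal{L}(\gamma)\cdot\left(\sqrt{1+\left(\frac{1}{\mathcal{L}(\gamma)}\int_0^{\mathcal{L}(\gamma)}\kappa(s)\,J_s(\ell)\,ds\right)^{2}}-1\right).$$
   Context: $(M,g)$ has Levi-Civita covariant derivative $D$ and curvature tensor $R$. A tractor curve is a smooth piecewise regular curve $\eta(t)$ in $M$. A pulled tractrix (put $\varepsilon=+1$), respectively pushed tractrix (put $\varepsilon=-1$), of $\eta$ with pole length $\ell>0$ is a curve $\gamma$ such that, in an arc length parameter $s$, the unit speed geodesic $\lambda_s(u)$ with $\lambda_s(0)=\gamma(s)$ and $\lambda_s'(0)=\varepsilon\gamma'(s)$ satisfies $\lambda_s(\ell)=\eta(t(s))$ for some $t=t(s)$. The geodesic segment $\lambda_s(u)$, $u\in[0,\ell]$, is the (wagon) pole at $s$. The relevant tractor is the curve $s\mapsto\lambda_s(\ell)=\eta(t(s))$, $s\in[0,\mathcal{L}(\gamma)]$, and $\mathcal{L}(\cdot)$ denotes length. The geodesic curvature of $\gamma$ is $\kappa(s)=\|D_{\gamma'(s)}\gamma'(s)\|$. Let $\mathcal{J}_s(u)$ be the Jacobi field along $\lambda_s$, orthogonal to $\lambda_s'$, with $\mathcal{J}_s(0)=0$, $\mathcal{J}_s'(0)=\varepsilon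 D_{\gamma'(s)}\gamma'(s)$ and $D^2_{\lambda_s'(u)}\mathcal{J}_s(u)+R(\mathcal{J}_s(u),\lambda_s'(u))\lambda_s'(u)=0$. For $\kappa(s)>0$ put $J_s(u)=\|\mathcal{J}_s(u)\|/\kappa(s)$; the product $\kappa(s)J_s(u)$ always means $\|\mathcal{J}_s(u)\|$, which is $0$ when $\kappa(s)=0$. *)

(* Defs.v *)
(* Smooth manifolds, Riemannian metrics, geodesics and Jacobi fields, in the
   classical local-coordinate style, on top of MathComp-Analysis. *)
From HB Require Import structures.
From mathcomp Require Import all_boot all_order all_algebra.
From mathcomp Require Import all_classical all_reals all_analysis.
From mathcomp Require Import ring.

Set Implicit Arguments.
Unset Strict Implicit.
Unset Printing Implicit Defensive.

Import Order.TTheory GRing.Theory Num.Theory.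
Import numFieldNormedType.Exports.

Local Open Scope classical_set_scope.
Local Open Scope ring_scope.

Section Smooth.
Context {R : realType} {V W : normedModType R}.

(* C^k on an open set A of a finite-dimensional V: all iterated directional
   derivatives up to order k exist on A and those of order k are continuous. *)
Fixpoint Ck_on (k : nat) (A : set V) (f : V -> W) : Prop :=
  match k with
  | 0 => forall x, A x -> {for x, continuous f}
  | k'.+1 => forall v : V,
      (forall x, A x -> derivable f x v) /\ Ck_on k' A ('D_v f)
  end.

Definition smooth_on (A : set V) (f : V -> W) : Prop :=
  forall k, Ck_on k A f.

End Smooth.

(* A smooth n-manifold without boundary, given by a smooth atlas.  Charts are
   total functions whose values only matter on the chart domains: [chart_map i]
   maps [dom i] homeomorphically onto an open subset of R^n, with inverse
   [chart_inv i]. *)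
Record manifold (R : realType) (n : nat) := Manifold {
  mpoint :> topologicalType ;
  mpoint_hausdorff : hausdorff_space mpoint ;
  mpoint_second_countable : @second_countable mpoint ;
  chart : Type ;
  dom : chart -> set mpoint ;
  chart_map : chart -> mpoint -> 'rV[R]_n ;
  chart_inv : chart -> 'rV[R]_n -> mpoint ;
  dom_open : forall i, open (dom i) ;
  dom_cover : forall p, exists i, dom i p ;
  range_open : forall i, open (chart_map i @` dom i) ;
  chart_mapK : forall i p, dom i p -> chart_inv i (chart_map i p) = p ;
  chart_map_continuous : forall i p, dom i p ->
    {for p, continuous (chart_map i)} ;
  chart_inv_continuous : forall i x, (chart_map i @` dom i) x ->
    {for x, continuous (chart_inv i)} ;
  transition_smooth : forall i j,
    smooth_on (chart_map i @` (dom i `&` dom j)) (chart_map j \o chart_inv i)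
}.

Arguments chart {R n} M : rename.
Arguments dom {R n M} i : rename.
Arguments chart_map {R n M} i p : rename.
Arguments chart_inv {R n M} i x : rename.

Section Curves.
Context {R : realType} {n : nat} {M : manifold R n}.

Definition chart_at (p : M) : chart M := projT1 (cid (dom_cover p)).

(* Tangent vectors are row vectors of components, so the differential of the
   change of charts from i to j acts by right multiplication by this matrix. *)
Definition change_mx (i j : chart M) (p : M) : 'M[R]_n :=
  'J (chart_map j \o chart_inv i) (chart_map i p).

Definition smooth_curve (A : set R) (c : R -> M) : Prop :=
  [/\ open A,
      (forall t, A t -> {for t, continuous c}) &
      forall i, smooth_on (A `&` c @^-1` dom i) (chart_map i \o c)].

(* Smoothness on a compact interval is smoothness of some extension to an open
   neighbourhood; derivatives at end points are those of the extension and
   coincide with the one-sided derivatives. *)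
Definition smooth_curve_itv (a b : R) (c : R -> M) : Prop :=
  exists A, `[a, b]%classic `<=` A /\ smooth_curve A c.

(* Components, chart by chart, of a vector field along a curve c; [X i t] is
   only meaningful when c t lies in the domain of the chart i. *)
Definition vfield : Type := chart M -> R -> 'rV[R]_n.

Definition smooth_vfield_along (c : R -> M) (X : vfield) : Prop :=
  (forall t i j, dom i (c t) -> dom j (c t) ->
     X j t = X i t *m change_mx i j (c t)) /\
  (forall i, smooth_on (c @^-1` dom i) (X i)).

Definition velocity (c : R -> M) : vfield :=
  fun i => derive1 (chart_map i \o c).

End Curves.

Arguments vfield {R n} M.

Record riemannian_metric (R : realType) (n : nat) (M : manifold R n) :=
  RiemannianMetric {
  gram :> chart M -> 'rV[R]_n -> 'M[R]_n ;
  gram_smooth : forall i, smooth_on (chart_map i @` dom i) (gram i) ;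
  gram_sym : forall i (p : M), dom i p ->
    (gram i (chart_map i p))^T = gram i (chart_map i p) ;
  gram_posdef : forall i (p : M), dom i p -> forall v : 'rV[R]_n, v != 0 ->
    0 < (v *m gram i (chart_map i p) *m v^T) 0 0 ;
  gram_change : forall i j (p : M), dom i p -> dom j p ->
    gram i (chart_map i p) =
    change_mx i j p *m gram j (chart_map j p) *m (change_mx i j p)^T
}.

Section Riemannian.
Context {R : realType} {n : nat} {M : manifold R n}.
Variable g : riemannian_metric M.

(* The a-th partial derivative of a scalar function on R^n. *)
Definition partial (a : 'I_n) (f : 'rV[R]_n -> R) : 'rV[R]_n -> R :=
  'D_(delta_mx 0 a) f.

(* Gamma^d_{ab}: D_{\partial_a} \partial_b = \sum_d Gamma^d_{ab} \partial_d for
   the Levi-Civita covariant derivative D of g; see [christoffel_torsion_free]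
   and [christoffel_metric] below. *)
Definition christoffel (i : chart M) (d a b : 'I_n) (x : 'rV[R]_n) : R :=
  2^-1 * \sum_e invmx (g i x) d e *
    (partial a (fun y => g i y b e) x + partial b (fun y => g i y a e) x
     - partial e (fun y => g i y a b) x).

(* R^d_{abc}: R(\partial_a, \partial_b) \partial_c = \sum_d R^d_{abc} \partial_d
   with R(X, Y) Z = D_X D_Y Z - D_Y D_X Z - D_[X,Y] Z. *)
Definition curvature (i : chart M) (d a b c : 'I_n) (x : 'rV[R]_n) : R :=
  partial a (christoffel i d b c) x - partial b (christoffel i d a c) x
  + \sum_e (christoffel i e b c x * christoffel i d a e x
            - christoffel i e a c x * christoffel i d b e x).

(* The components of R(X, Y) Z in the chart i at coordinates x. *)
Definition curvature_op (i : chart M) (x X Y Z : 'rV[R]_n) : 'rV[R]_n :=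
  \row_d \sum_a \sum_b \sum_c curvature i d a b c x * X 0 a * Y 0 b * Z 0 c.

(* The covariant derivative D_{c'} X of a vector field X along c. *)
Definition covD (c : R -> M) (X : vfield M) : vfield M :=
  fun i t => derive1 (X i) t +
    \row_d \sum_a \sum_b christoffel i d a b (chart_map i (c t)) *
      velocity c i t 0 a * X i t 0 b.

(* Independent of the chart, for X and Y transforming as tangent vectors. *)
Definition inner (c : R -> M) (X Y : vfield M) (t : R) : R :=
  let i := chart_at (c t) in
  (X i t *m g i (chart_map i (c t)) *m (Y i t)^T) 0 0.

Definition field_norm (c : R -> M) (X : vfield M) (t : R) : R :=
  Num.sqrt (inner c X X t).

Definition speed (c : R -> M) (t : R) : R := field_norm c (velocity c) t.

Definition curve_length (a b : R) (c : R -> M) : R :=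
  \int[lebesgue_measure]_(t in `[a, b]) speed c t.

(* D_{c'} c' *)
Definition acceleration (c : R -> M) : vfield M := covD c (velocity c).

Definition geodesic (c : R -> M) : Prop :=
  smooth_curve setT c /\
  forall t i, dom i (c t) -> acceleration c i t = 0.

(* Completeness: every exp_p is defined on the whole tangent space. *)
Definition riemannian_complete : Prop :=
  forall (p : M) (i : chart M) (v : 'rV[R]_n), dom i p ->
    exists c : R -> M, [/\ geodesic c, c 0 = p & velocity c i 0 = v].

Definition jacobi_field (c : R -> M) (X : vfield M) : Prop :=
  smooth_vfield_along c X /\
  forall t i, dom i (c t) ->
    covD c (covD c X) i t +
    curvature_op i (chart_map i (c t)) (X i t) (velocity c i t) (velocity c i t)
    = 0.

(* The geodesic curvature of a curve parametrized by arc length. *)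
Definition geodesic_curvature (c : R -> M) (s : R) : R :=
  field_norm c (acceleration c) s.

(* A smooth curve on [a, b], regular away from finitely many parameters. *)
Definition tractor_curve (a b : R) (eta : R -> M) : Prop :=
  [/\ a < b, smooth_curve_itv a b eta &
      exists F : seq R, forall t, a <= t <= b -> t \notin F -> 0 < speed eta t].

(* [lam s] is the pole at s of gamma : [0, L] -> M, which is parametrized by arc
   length; the tractrix is pulled for eps = 1 and pushed for eps = -1.  The
   poles are the restrictions to [0, ell] of the geodesics [lam s]. *)
Definition tractrix (eps ell a b : R) (eta : R -> M) (L : R) (gamma : R -> M)
    (lam : R -> R -> M) (t : R -> R) : Prop :=
  [/\ smooth_curve_itv 0 L gamma,
      forall s, 0 <= s <= L -> speed gamma s = 1 &
      forall s, 0 <= s <= L ->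
        [/\ geodesic (lam s) /\ (forall u, speed (lam s) u = 1),
            lam s 0 = gamma s,
            forall i, dom i (gamma s) ->
              velocity (lam s) i 0 = eps *: velocity gamma i s,
            a <= t s <= b &
            lam s ell = eta (t s)]].

Definition pole_jacobi (eps L : R) (gamma : R -> M) (lam : R -> R -> M)
    (J : R -> vfield M) : Prop :=
  forall s, 0 <= s <= L ->
    [/\ jacobi_field (lam s) (J s),
        forall u, inner (lam s) (J s) (velocity (lam s)) u = 0,
        forall i, dom i (gamma s) -> J s i 0 = 0 &
        forall i, dom i (gamma s) ->
          covD (lam s) (J s) i 0 = eps *: acceleration gamma i s].

(* For vanishing curvature this is 0, by the convention x / 0 = 0; hence
   geodesic_curvature gamma s * normalized_jacobi gamma lam J s u is always the
   norm of J s at u, since J s = 0 where the curvature vanishes. *)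
Definition normalized_jacobi (gamma : R -> M) (lam : R -> R -> M)
    (J : R -> vfield M) (s u : R) : R :=
  field_norm (lam s) (J s) u / geodesic_curvature gamma s.

Lemma gram_entry_sym (i : chart M) (p : M) (e a b : 'I_n) : dom i p ->
  partial e (fun y => g i y a b) (chart_map i p) =
  partial e (fun y => g i y b a) (chart_map i p).
Proof.
move=> ip; apply: near_eq_derive; near=> y.
have [q iq <-] : (chart_map i @` dom i) y.
  near: y; apply: open_nbhs_nbhs; split; first exact: range_open.
  by exists p.
by rewrite -[in LHS](gram_sym g iq) mxE.
Unshelve. all: by end_near.
Qed.

Lemma gram_unit (i : chart M) (p : M) :
  dom i p -> g i (chart_map i p) \in unitmx.
Proof.
move=> ip; rewrite -row_free_unit -kermx_eq0; apply/eqP/row_matrixP => k.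
rewrite row0; apply/eqP/negPn/negP => /(gram_posdef g ip).
by rewrite -row_mul mulmx_ker row0 mul0mx mxE ltxx.
Qed.

Lemma christoffel_torsion_free (i : chart M) (p : M) (d a b : 'I_n) :
  dom i p ->
  christoffel i d a b (chart_map i p) = christoffel i d b a (chart_map i p).
Proof.
move=> ip; rewrite /christoffel; congr (_ * _); apply: eq_bigr => e _.
by rewrite (gram_entry_sym e a b ip) [X in X - _]addrC.
Qed.

Lemma christoffel_lower (i : chart M) (p : M) (e a b : 'I_n) : dom i p ->
  \sum_d christoffel i d e a (chart_map i p) * g i (chart_map i p) d b =
  2^-1 * (partial e (fun y => g i y a b) (chart_map i p) +
          partial a (fun y => g i y e b) (chart_map i p) -
          partial b (fun y => g i y e a) (chart_map i p)).
Proof.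
move=> ip; set x := chart_map i p.
pose r := \row_f (partial e (fun y => g i y a f) x +
   partial a (fun y => g i y e f) x - partial f (fun y => g i y e a) x).
have symV : (invmx (g i x))^T = invmx (g i x) by rewrite trmx_inv gram_sym.
transitivity (2^-1 * (r *m invmx (g i x) *m g i x) 0 b); last first.
  by rewrite mulmxKV ?gram_unit// !mxE.
rewrite mxE mulr_sumr; apply: eq_bigr => d _; rewrite mulrA; congr (_ * _ * _).
rewrite mxE; apply: eq_bigr => f _.
by rewrite [LHS]mulrC -{1}symV !mxE.
Qed.

Lemma christoffel_metric (i : chart M) (p : M) (a b e : 'I_n) : dom i p ->
  partial e (fun y => g i y a b) (chart_map i p) =
  \sum_d (christoffel i d e a (chart_map i p) * g i (chart_map i p) d b +
          christoffel i d e b (chart_map i p) * g i (chart_map i p) a d).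
Proof.
move=> ip; rewrite big_split/= christoffel_lower//.
under [X in _ + X]eq_bigr => d _ do rewrite -(gram_sym g ip) mxE.
rewrite christoffel_lower// (gram_entry_sym e b a ip).
by rewrite (gram_entry_sym a e b ip) (gram_entry_sym b e a ip); field.
Qed.

End Riemannian.

(* Main.v *)
Require Import Defs.
From HB Require Import structures.
From mathcomp Require Import all_boot all_order all_algebra.
From mathcomp Require Import all_classical all_reals all_analysis.
From mathcomp Require Import ring lra measurable_realfun.
Import Order.TTheory GRing.Theory Num.Theory.
Import numFieldNormedType.Exports.
Local Open Scope classical_set_scope.
Local Open Scope ring_scope.

(** The poles [lam s] form a one-parameter family of geodesics, and the tractor
is the curve of their end points, so its velocity is the variation field of
this family at [ell].  A variation field of geodesics is a Jacobi field; its
initial value is [gamma'] and its initial derivative is [eps D gamma'], so it is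
[Z = eps T + J], where [T] is the velocity of the pole and [J] the given normal
Jacobi field.  As [T] has norm one and is orthogonal to [J], the tractor has
speed [sqrt (1 + |J|^2)] ([tractor_speed]).  It remains to integrate:
[x |-> sqrt (1 + x^2)] is convex, and Jensen's inequality, in the form of its
tangent line at the mean of [kappa J], gives the bound
([integral_sqrt_lower_bound]).

The substance of the proof is that the end points of the poles do depend
differentiably on [s], with derivative [Z].  Only one geodesic for each [s] is
given, so the derivative is not produced by a flow; instead the candidate [Z]
is available from the start and the remainder
[lam (s + h) - lam s - h Z s] is estimated.  In a chart, the pair
[y = (x, x')] of position and velocity solves an autonomous equation
[y' = geofield y], and [(Z, Z')] solves its linearization: for [T] this is the
derivative of the geodesic equation, for [J] it is the Jacobi equation written
out in coordinates ([jacobi_linearized]).  Taylor's formula for [geofield] and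
Gronwall's inequality bound the remainder at a later time by the remainder at an
earlier time plus a quadratic error ([ode_comparison]); the same lemma gives
continuity of [Z] in [s], which makes the speed of the tractor integrable.

One chart covers only a short piece of a pole.  Unit speed curves starting near
the centre of a small chart ball stay in it for a time independent of the curve
([unit_speed_stays]), which makes the comparison possible on short intervals
([varies_local]); between two such intervals the estimates are transported by
the induced change of charts of the tangent bundle ([varies_change]), where the
symmetry of second derivatives is used ([schwarz], [lift_change]).  A supremum
argument then reaches the end of the pole ([varies]). *)

Set Implicit Arguments.
Unset Strict Implicit.
Unset Printing Implicit Defensive.

(** * Directional derivatives and differentiability *)

Section Line.
Context {R : realType} {V W : normedModType R}.
Implicit Types (f : V -> W) (x v : V).

Lemma is_derive_line f x v t : derivable f (x + t *: v) v ->
  is_derive t 1 (fun r => f (x + r *: v)) ('D_v f (x + t *: v)).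
Proof.
have E : (fun h : R => h^-1 *: (((fun r => f (x + r *: v)) \o shift t) (h *: 1)
            - f (x + t *: v))) =
         (fun h => h^-1 *: ((f \o shift (x + t *: v)) (h *: v)
            - f (x + t *: v))).
  apply/funext => h /=; congr (_ *: (f _ - _)).
  by rewrite [h%:A]mulr1 scalerDl addrCA.
move=> df; apply: DeriveDef; first by rewrite /derivable E.
by rewrite /derive E.
Qed.

Lemma is_derive_scale (a : R) f x v : derivable f x v ->
  is_derive x (a *: v) f (a *: 'D_v f x).
Proof.
move=> df.
have [->|a0] := eqVneq a 0; first by rewrite !scale0r; exact: is_derive0.
have fl : ((fun h => (a * h)^-1 *: ((f \o shift x) ((a * h) *: v) - f x))
    @ 0^') --> 'D_v f x.
  have df' : ((fun h => h^-1 *: ((f \o shift x) (h *: v) - f x)) @ 0^') -->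
     'D_v f x by exact: df.
  apply: (@cvg_comp _ _ _ (fun h : R => a * h) _ _ (0^') _ _ df') => A [e /= e0 eA].
  exists (e / `|a|); first by rewrite /= divr_gt0// normr_gt0.
  move=> h /=; rewrite sub0r normrN ltr_pdivlMr ?normr_gt0// => he h0.
  by apply: eA; rewrite /= ?sub0r ?normrN ?normrM 1?mulrC// mulf_neq0.
have fl' : ((fun h => h^-1 *: ((f \o shift x) (h *: (a *: v)) - f x))
    @ 0^') --> a *: 'D_v f x.
  apply: (cvg_trans _ (@cvgZl_tmp _ _ _ _ _ a _ _ fl)); apply: near_eq_cvg.
  near=> h.
  rewrite /= !scalerA [h * a]mulrC invfM mulrA divff// mul1r//.
apply: DeriveDef; first by apply/cvg_ex; exists (a *: 'D_v f x).
exact: cvg_lim fl'.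
Unshelve. all: by end_near. Qed.

End Line.

Section MeanValue.
Context {R : realType} {V : normedModType R}.
Implicit Types (f : V -> R) (x v : V) (A : set V).

Lemma mvt_line f x v :
  (forall t : R, t \in `[0, 1]%R -> derivable f (x + t *: v) v) ->
  exists2 t, t \in `]0, 1[%R & f (x + v) - f x = 'D_v f (x + t *: v).
Proof.
move=> df.
have df' (t : R) : t \in `[0, 1]%R ->
    is_derive t 1 (fun r => f (x + r *: v)) ('D_v f (x + t *: v)).
  by move=> /df /is_derive_line.
have dc (t : R) : t \in `]0, 1[%R ->
    is_derive t 1 (fun r => f (x + r *: v)) ('D_v f (x + t *: v)).
  by move=> t01; apply: df'; apply: subset_itv_oo_cc t01.
have cc : {within `[0, 1], continuous (fun r : R => f (x + r *: v))}.
  by apply: derivable_within_continuous => t' t01; have [] := df' _ t01.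
have [t t01] := MVT ltr01 dc cc.
by rewrite scale1r scale0r addr0 subr0 mulr1; exists t.
Qed.

(** The difference quotient in direction [u + v] is one in direction [u] at [x]
plus one in direction [v] at the moving point [x + h u]; the mean value theorem
turns the latter into [D_v f] at a point close to [x]. *)
Lemma deriveDdir f x u v : (\forall y \near x, derivable f y v) ->
  derivable f x u -> {for x, continuous ('D_v f)} ->
  is_derive x (u + v) f ('D_u f x + 'D_v f x).
Proof.
move=> dv du cv.
suff fl : ((fun h => h^-1 *: ((f \o shift x) (h *: (u + v)) - f x)) @ 0^') -->
    'D_u f x + 'D_v f x.
  apply: DeriveDef; first by apply/cvg_ex; exists ('D_u f x + 'D_v f x).
  exact: cvg_lim fl.
have -> : (fun h => h^-1 *: ((f \o shift x) (h *: (u + v)) - f x)) =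
   (fun h => h^-1 *: ((f \o shift x) (h *: u) - f x)
      + h^-1 *: (f (h *: u + x + h *: v) - f (h *: u + x))).
  apply/funext => h /=; rewrite -scalerDr; congr (_ *: _).
  by rewrite [RHS]addrC subrKA scalerDr addrAC.
apply: cvgD; first exact: du.
apply/cvgrPdist_lt => e e0.
have /cvgrPdist_lt/(_ _ e0) cv' := cv.
have /nbhs_ballP[r /= r0 rP] : \forall y \near x,
    derivable f y v /\ `|'D_v f x - 'D_v f y| < e.
  by near=> y; split; near: y.
pose d := r / (`|u| + `|v| + 1).
have d0 : 0 < d by rewrite divr_gt0// ltr_wpDl// addr_ge0.
near=> h.
have h0 : h != 0 by near: h; exact: nbhs_dnbhs_neq.
have hd : `|h| < d by near: h; exact: dnbhs0_lt.
have inr (t : R) : t \in `[0, 1]%R -> ball x r (h *: u + x + t *: (h *: v)).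
  rewrite in_itv/= => /andP[t0 t1].
  rewrite -ball_normE /ball_/= -addrA addrCA opprD addrA subrr add0r normrN.
  apply: (le_lt_trans (ler_normD _ _)); rewrite !normrZ.
  have : `|h| * (`|u| + `|v| + 1) < r.
    by rewrite -ltr_pdivlMr// ltr_wpDl// addr_ge0.
  apply: le_lt_trans.
  rewrite !mulrDr mulr1 -[leLHS]addr0 lerD// lerD2l.
  by rewrite ger0_norm// ler_piMl// mulr_ge0.
have [t t01 ->] := @mvt_line f (h *: u + x) (h *: v)
   (fun t tP => @ex_derive _ _ _ _ _ _ _
    (is_derive_scale h (proj1 (rP _ (inr t tP))))).
have [/= df' lt'] := rP _ (inr t (subset_itv_oo_cc t01)).
by rewrite (@derive_val _ _ _ _ _ _ _ (is_derive_scale h df')) [h^-1 *: _]scalerA mulVf// scale1r.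
Unshelve. all: by end_near. Qed.

End MeanValue.

Section CkCongruence.
Context {R : realType} {V W : normedModType R}.

Lemma Ck_on_eq k (A : set V) (f g : V -> W) : open A ->
  (forall x, A x -> f x = g x) -> Ck_on k A f -> Ck_on k A g.
Proof.
move=> oA; elim: k f g => [|k IH] f g fg.
  move=> cf x Ax; have fgx : \forall y \near x, f y = g y.
    by apply: filterS (open_nbhs_nbhs (conj oA Ax)).
  suff : g @ x --> g x by [].
  rewrite -(fg _ Ax).
  by apply: (cvg_trans _ (cf x Ax)); exact: near_eq_cvg.
move=> cf v; have [df Df] := cf v; split.
  move=> x Ax; apply: (@near_eq_derivable _ _ _ f) (df x Ax).
  by apply: filterS (open_nbhs_nbhs (conj oA Ax)).
apply: IH Df => x Ax; apply: near_eq_derive.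
by apply: filterS (open_nbhs_nbhs (conj oA Ax)).
Qed.

Lemma Ck_on_sub k (A B : set V) (f : V -> W) : B `<=` A ->
  Ck_on k A f -> Ck_on k B f.
Proof.
move=> BA; elim: k f => [|k IH] f; first by move=> cf x /BA /cf.
by move=> cf v; have [df Df] := cf v; split; [move=> x /BA /df|exact: IH].
Qed.

Lemma smooth_on_derivable (A : set V) (f : V -> W) x v :
  smooth_on A f -> A x -> derivable f x v.
Proof. by move=> /(_ 1%N v) [+ _]; apply. Qed.

Lemma smooth_on_derive (A : set V) (f : V -> W) v :
  smooth_on A f -> smooth_on A ('D_v f).
Proof. by move=> sf k; have [_] := sf k.+1 v. Qed.

Lemma smooth_on_continuous (A : set V) (f : V -> W) x :
  smooth_on A f -> A x -> {for x, continuous f}.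
Proof. by move=> /(_ 0%N); exact. Qed.

End CkCongruence.

Lemma cvg_sum {R : numFieldType} {W : normedModType R} {T I : Type}
    (F : set_system T) (r : seq I) (P : pred I) (f : I -> T -> W) (l : I -> W) :
  Filter F -> (forall i, P i -> f i x @[x --> F] --> l i) ->
  \sum_(i <- r | P i) f i x @[x --> F] --> \sum_(i <- r | P i) l i.
Proof. by move=> FF fl; apply: cvg_big => // x; exact: add_continuous. Qed.

Lemma near0_norm_lt {R : realType} (V : normedModType R) (r : R) : 0 < r ->
  \forall v \near (0 : V), `|v| < r.
Proof. by move=> r0; exact: nbhs0_lt. Qed.

Lemma differentiable_eps {R : realType} {V W : normedModType R} (f : V -> W)
    (L : {linear V -> W}) x : continuous L ->
  (forall e : R, 0 < e ->
     \forall v \near 0, `|f (v + x) - f x - L v| <= e * `|v|) ->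
  differentiable f x.
Proof.
move=> cL fL; apply/diff_locallyP.
suff E : f \o shift x = cst (f x) + L +o_ 0 id by rewrite (diff_unique cL E).
apply/eqaddoP => e e0; have := fL e e0; apply: filterS => v.
by rewrite /= !fctE/= opprD addrA.
Qed.

Section RowVectors.
Context {R : realType} {n : nat}.
Local Notation V := 'rV[R]_n.
Implicit Types (A : set V) (f : V -> R).

Lemma norm_coord_le m p (M : 'M[R]_(m, p)) i j : `|M i j| <= `|M|.
Proof.
rewrite [leRHS]/Num.norm/= mx_normrE.
exact: (le_bigmax _ (fun ij => `|M ij.1 ij.2|) (i, j)).
Qed.

Lemma norm_le_coord m p (M : 'M[R]_(m, p)) (e : R) : 0 <= e ->
  (forall i j, `|M i j| <= e) -> `|M| <= e.
Proof.
move=> e0 Me; rewrite [leLHS]/Num.norm/= mx_normrE.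
by apply: bigmax_le => // -[i j] _; exact: Me.
Qed.

(** Directional derivatives are in general not additive in the direction; under
continuity they are, by [deriveDdir], so the partial derivatives determine all
of them. *)
Lemma C1_deriveE A f x v : open A -> Ck_on 1 A f -> A x ->
  'D_v f x = \sum_e v 0 e * partial e f x.
Proof.
move=> oA cf Ax.
have dd u y : A y -> derivable f y u by move=> Ay; have [+ _] := cf u; apply.
have add u w : 'D_(u + w) f x = 'D_u f x + 'D_w f x.
  apply: (@derive_val _ _ _ _ _ _ _); apply: deriveDdir => //.
  - by apply: filterS (open_nbhs_nbhs (conj oA Ax)) => y; exact: dd.
  - exact: dd.
  - by have [_] := cf w; apply.
rewrite {1}[v]row_sum_delta; elim/big_ind2 : _ => [|u a w b|e _].
- by rewrite derive0.
- by move=> <- <-.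
- by rewrite (@derive_val _ _ _ _ _ _ _ (is_derive_scale _ (dd _ _ Ax))).
Qed.

(** By the mean value theorem the remainder at [x + v] is [D_v f] at an
intermediate point minus [D_v f x], that is, a sum of increments of partial
derivatives weighted by the coordinates of [v]. *)
Lemma C1_differentiable A f x : open A -> Ck_on 1 A f -> A x ->
  differentiable f x.
Proof.
move=> oA cf Ax.
pose L := fun v : V => \sum_e v 0 e * partial e f x.
have linL : linear L.
  move=> a u w; rewrite /L scaler_sumr -big_split/=; apply: eq_bigr => e _.
  by rewrite !mxE mulrDl -mulrA.
pose lL := GRing.isLinear.Build _ _ _ _ _ linL.
pose LL : {linear V -> R} := HB.pack L lL.
have cL : continuous LL.
  move=> y; apply: (@cvg_sum _ _ _ _ (nbhs y) _ _
    (fun e (v : V) => v 0 e * partial e f x)) => e _.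
  by apply: cvgMr_tmp; exact: coord_continuous.
apply: (differentiable_eps cL) => e e0.
pose e' := e / (n.+1)%:R.
have e'0 : 0 < e' by rewrite divr_gt0.
have /nbhs_ballP[r /= r0 rP] : \forall y \near x,
    A y /\ forall a, `|partial a f x - partial a f y| < e'.
  near=> y; split; first by near: y; exact: open_nbhs_nbhs.
  near: y; apply: filter_forall => a.
  by have [_ /(_ _ Ax)/cvgrPdist_lt/(_ _ e'0)] := cf (delta_mx 0 a).
near=> v.
have vr : `|v| < r.
  by near: v; exact: (@near0_norm_lt R V r r0).
have inr (t : R) : t \in `[0, 1]%R -> ball x r (x + t *: v).
  rewrite in_itv/= => /andP[t0 t1].
  rewrite -ball_normE /ball_/= opprD addrA subrr add0r normrN normrZ.
  by rewrite (le_lt_trans _ vr)// ger0_norm// ler_piMl.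
have [|t t01 tE] := @mvt_line R V f x v.
  by move=> t /inr/rP[Ay _]; have [+ _] := cf v; apply.
have [At Pt] := rP _ (inr t (subset_itv_oo_cc t01)).
rewrite [v + x]addrC tE (C1_deriveE v oA cf At).
rewrite /L -sumrB; apply: (le_trans (ler_norm_sum _ _ _)).
apply: (@le_trans _ _ (\sum_(a < n) `|v| * e')).
  apply: ler_sum => a _; rewrite -mulrBr normrM ler_pM// ?norm_coord_le//.
  by rewrite distrC ltW.
rewrite sumr_const card_ord -mulr_natr -mulrA mulrC ler_wpM2r//.
by rewrite /e' mulrAC ler_pdivrMr// ler_pM2l// ler_nat.
Unshelve. all: by end_near. Qed.

Lemma differentiable_mx m p (U : normedModType R) (F : U -> 'M[R]_(m, p)) x :
  (forall i j, differentiable (fun y => F y i j) x) -> differentiable F x.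
Proof.
move=> dF.
have -> : F = fun y => \sum_i \sum_j F y i j *: delta_mx i j.
  by apply/funext => y; rewrite -matrix_sum_delta.
have -> : (fun y => \sum_i \sum_j F y i j *: delta_mx i j) =
   \sum_i \sum_j (fun y => F y i j *: delta_mx i j).
  by apply/funext => y; rewrite fct_sumE; apply: eq_bigr => i _; rewrite fct_sumE.
apply: differentiable_sum => i; apply: differentiable_sum => j.
exact: differentiableZl.
Qed.

End RowVectors.

(** * Algebra of C^k functions *)

Section CkAlgebra.
Context {R : realType} {n : nat}.
Local Notation V := 'rV[R]_n.
Implicit Types (A : set V) (f g : V -> R).

Lemma C1_continuous A f x : open A -> Ck_on 1 A f -> A x ->
  {for x, continuous f}.
Proof.
by move=> oA cf Ax; apply: differentiable_continuous; exact: C1_differentiable cf Ax.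
Qed.

(** [Ck_on] requires continuity of the derivatives of the highest order only;
continuity of the lower ones comes from differentiability. *)
Lemma Ck_onS k A f : open A -> Ck_on k.+1 A f -> Ck_on k A f.
Proof.
move=> oA; elim: k f => [|k IH] f cf; first by move=> x; exact: C1_continuous.
move=> v; have [df Df] := cf v; split => //; exact: IH.
Qed.

Lemma Ck_on_cst k A (c : R) : Ck_on k A (fun=> c).
Proof.
elim: k c => [|k IH] c; first by move=> x _; exact: cst_continuous.
move=> v; split; first by move=> x _; exact: derivable_cst.
rewrite (_ : 'D_v _ = fun=> 0); first exact: IH.
by apply/funext => x; exact: derive_cst.
Qed.

Lemma Ck_onD k A f g : open A -> Ck_on k A f -> Ck_on k A g ->
  Ck_on k A (fun x => f x + g x).
Proof.
move=> oA; elim: k f g => [|k IH] f g cf cg.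
  by move=> x Ax; exact: (continuousD (cf x Ax) (cg x Ax)).
move=> v; have [df Df] := cf v; have [dg Dg] := cg v; split.
  by move=> x Ax; apply: derivableD; [exact: df|exact: dg].
apply: Ck_on_eq oA _ (IH _ _ Df Dg) => x Ax /=.
by rewrite -deriveD//; [exact: df|exact: dg].
Qed.

Lemma Ck_onM k A f g : open A -> Ck_on k A f -> Ck_on k A g ->
  Ck_on k A (fun x => f x * g x).
Proof.
move=> oA; elim: k f g => [|k IH] f g cf cg.
  by move=> x Ax; exact: (continuousM (cf x Ax) (cg x Ax)).
move=> v; have [df Df] := cf v; have [dg Dg] := cg v; split.
  by move=> x Ax; apply: derivableM; [exact: df|exact: dg].
apply: Ck_on_eq oA _
  (Ck_onD oA (IH _ _ (Ck_onS oA cf) Dg) (IH _ _ (Ck_onS oA cg) Df)) => x Ax /=.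
by rewrite -[LHS](@deriveM _ _ f g)//; [exact: df|exact: dg].
Qed.

Lemma Ck_onN k A f : open A -> Ck_on k A f -> Ck_on k A (fun x => - f x).
Proof.
move=> oA cf; apply: Ck_on_eq oA _ (Ck_onM oA (Ck_on_cst k A (-1)) cf) => x _.
by rewrite mulN1r.
Qed.

Lemma Ck_onB k A f g : open A -> Ck_on k A f -> Ck_on k A g ->
  Ck_on k A (fun x => f x - g x).
Proof. by move=> oA cf cg; apply: Ck_onD => //; exact: Ck_onN. Qed.

Lemma Ck_onZ k A (c : R) f : open A -> Ck_on k A f -> Ck_on k A (fun x => c * f x).
Proof. by move=> oA cf; apply: Ck_onM => //; exact: Ck_on_cst. Qed.

Lemma Ck_on_sum k A (I : Type) (r : seq I) (P : pred I) (F : I -> V -> R) :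
  open A -> (forall i, Ck_on k A (F i)) ->
  Ck_on k A (fun x => \sum_(i <- r | P i) F i x).
Proof.
move=> oA cF; elim: r => [|i r IH].
  by under eq_fun do rewrite big_nil; exact: Ck_on_cst.
under eq_fun do rewrite big_cons; case: (P i) => //.
exact: Ck_onD.
Qed.

Lemma Ck_on_prod k A (I : Type) (r : seq I) (P : pred I) (F : I -> V -> R) :
  open A -> (forall i, Ck_on k A (F i)) ->
  Ck_on k A (fun x => \prod_(i <- r | P i) F i x).
Proof.
move=> oA cF; elim: r => [|i r IH].
  by under eq_fun do rewrite big_nil; exact: Ck_on_cst.
under eq_fun do rewrite big_cons; case: (P i) => //.
exact: Ck_onM.
Qed.

Lemma Ck_onV k A f : open A -> (forall x, A x -> f x != 0) -> Ck_on k A f ->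
  Ck_on k A (fun x => (f x)^-1).
Proof.
move=> oA f0; elim: k => [|k IH] cf.
  by move=> x Ax; exact: (continuousV (f0 x Ax) (cf x Ax)).
have {}IH := IH (Ck_onS oA cf).
move=> v; have [df Df] := cf v; split.
  by move=> x Ax; apply: derivableV; [exact: f0|exact: df].
apply: Ck_on_eq oA _ (Ck_onN oA (Ck_onM oA (Ck_onM oA IH IH) Df)) => x Ax /=.
rewrite [RHS](@deriveV _ _ f)//; [|exact: f0|exact: df].
by rewrite scaleNr expr2 invfM.
Qed.

Lemma Ck_on_coord k A e : Ck_on k A (fun x : V => x 0 e).
Proof.
case: k => [|k]; first by move=> x _; exact: coord_continuous.
have D v x : is_derive x v (fun x : V => x 0 e) (v 0 e).
  have d : derivable (id : V -> V) x v by exact: derivable_id.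
  have d' := (derivable_mxP (id : V -> V) x v).1 d 0 e.
  apply: DeriveDef => //.
  have := derive_mx d; rewrite derive_id => /matrixP/(_ 0 e).
  by rewrite mxE.
move=> v; split; first by move=> x _; have [] := D v x.
rewrite (_ : 'D_v _ = fun=> v 0 e); first exact: Ck_on_cst.
by apply/funext => x; have [] := D v x.
Qed.

End CkAlgebra.

(** Differentiating [f \o L] along [v] amounts to differentiating [f] along
[L v], so smoothness is inherited order by order. *)
Lemma Ck_on_linear {R : realType} {m n : nat} k (A : set 'rV[R]_n)
    (f : 'rV[R]_n -> R) (L : {linear 'rV[R]_m -> 'rV[R]_n}) :
  continuous L -> Ck_on k A f -> Ck_on k (L @^-1` A) (f \o L).
Proof.
move=> cL; elim: k f => [|k IH] f cf.
  by move=> x Ax; exact: (continuous_comp (cL x) (cf _ Ax)).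
have E v x : (fun h : R => h^-1 *: (((f \o L) \o shift x) (h *: v) - (f \o L) x))
    = (fun h => h^-1 *: ((f \o shift (L x)) (h *: L v) - f (L x))).
  by apply/funext => h /=; rewrite linearP.
move=> v; have [df Df] := cf (L v); split.
  by move=> x Ax; rewrite /derivable E; exact: df.
rewrite (_ : 'D_v (f \o L) = 'D_(L v) f \o L); first exact: IH.
by apply/funext => x; rewrite /derive /= E.
Qed.

Section CkComponents.
Context {R : realType} {n m p : nat}.
Implicit Types (A : set 'rV[R]_n) (F : 'rV[R]_n -> 'M[R]_(m, p)).

Lemma Ck_on_entry k A F i j : open A -> Ck_on k A F ->
  Ck_on k A (fun x => F x i j).
Proof.
move=> oA; elim: k F => [|k IH] F cF.
  move=> x Ax; exact: (continuous_comp (cF x Ax) (@coord_continuous _ _ _ i j _)).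
move=> v; have [dF DF] := cF v; split.
  by move=> x Ax; exact: ((derivable_mxP F x v).1 (dF x Ax) i j).
apply: Ck_on_eq oA _ (IH _ DF) => x Ax.
by rewrite derive_mx ?mxE//; exact: dF.
Qed.

Lemma C1_mx_differentiable A F x : open A ->
  (forall i j, Ck_on 1 A (fun x => F x i j)) -> A x -> differentiable F x.
Proof.
move=> oA cF Ax; apply: differentiable_mx => i j.
exact: C1_differentiable (cF i j) Ax.
Qed.

Lemma derive_entry (U : normedModType R) (G : U -> 'M[R]_(m, p)) x v i j :
  derivable G x v -> ('D_v G x) i j = 'D_v (fun y => G y i j) x.
Proof. by move=> dG; rewrite derive_mx// mxE. Qed.

Lemma is_derive_mxE (U : normedModType R) (G : U -> 'M[R]_(m, p)) x v
    (dG : 'M[R]_(m, p)) i j :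
  is_derive x v G dG -> is_derive x v (fun y => G y i j) (dG i j).
Proof.
move=> [d <-]; rewrite derive_entry//.
by apply: DeriveDef => //; exact: ((derivable_mxP G x v).1 d).
Qed.

End CkComponents.

Lemma chain_curve {R : realType} {m : nat} {W : normedModType R}
    (c : R -> 'rV[R]_m) (F : 'rV[R]_m -> W) (t : R) (dc : 'rV[R]_m) :
  is_derive t 1 c dc -> differentiable F (c t) ->
  is_derive t 1 (F \o c) ('D_dc F (c t)).
Proof.
move=> [dc1 dcE] dF.
have dc' : differentiable c t by apply/derivable1_diffP.
have dFc : differentiable (F \o c) t by exact: differentiable_comp.
apply: DeriveDef; first exact/derivable1_diffP.
by rewrite deriveE// diff_comp//= -[X in 'd F _ X]deriveE// dcE -deriveE.
Qed.

Lemma jacobian_entry {R : realType} {m n : nat} (F : 'rV[R]_m -> 'rV[R]_n) x a b :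
  differentiable F x -> ('J F x) a b = partial a (fun y => F y 0 b) x.
Proof.
move=> dF; rewrite /partial -derive_entry; last exact: diff_derivable.
by rewrite deriveEjacobian// -rowE [RHS]mxE.
Qed.

(** * Symmetry of second derivatives and Taylor estimates *)

Lemma dist_le_split {R : realFieldType} (e a b c : R) :
  `|b - a| < e / 2 -> `|c - a| < e / 2 -> `|b - c| <= e.
Proof.
move=> /ltW ba /ltW ca; rewrite [e]splitr -(subrKA a).
by rewrite (le_trans (ler_normD _ _))// lerD// distrC.
Qed.

Section Schwarz.
Context {R : realType} {n : nat}.
Local Notation V := 'rV[R]_n.
Implicit Types (A : set V) (f : V -> R).

Lemma is_derive_translate (U W : normedModType R) (f : U -> W) a x v :
  derivable f (x + a) v ->
  is_derive x v (fun y => f (y + a)) ('D_v f (x + a)).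
Proof.
have E : (fun h : R => h^-1 *: (((fun y => f (y + a)) \o shift x) (h *: v)
            - f (x + a))) =
         (fun h => h^-1 *: ((f \o shift (x + a)) (h *: v) - f (x + a))).
  by apply/funext => h /=; rewrite addrA.
move=> df; apply: DeriveDef; first by rewrite /derivable E.
by rewrite /derive E.
Qed.

(** Two applications of the mean value theorem: first to the function
[y |-> f (y + h v) - f y] along [h u], then to [D_u f] along [h v]. *)
Lemma second_difference f x u v (r h : R) : Ck_on 2 (ball x r) f ->
  `|h| * (`|u| + `|v|) < r ->
  exists2 y, ball x r y &
    f (x + h *: u + h *: v) - f (x + h *: u) - f (x + h *: v) + f x =
    h * h * 'D_v ('D_u f) y.
Proof.
move=> cf hr.
have inr (s t : R) : s \in `[0, 1]%R -> t \in `[0, 1]%R ->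
    ball x r (x + s *: (h *: u) + t *: (h *: v)).
  rewrite !in_itv/= => /andP[s0 s1] /andP[t0 t1].
  rewrite -ball_normE /ball_/= -addrA opprD addrA subrr add0r normrN.
  apply: le_lt_trans hr; apply: (le_trans (ler_normD _ _)).
  by rewrite !normrZ mulrDr lerD// ger0_norm// ler_piMl// mulr_ge0.
have i0 : (0 : R) \in `[0, 1]%R by rewrite in_itv/= lexx ler01.
have i1 : (1 : R) \in `[0, 1]%R by rewrite in_itv/= lexx ler01.
have df y w : ball x r y -> derivable f y w.
  by move=> yr; have [+ _] := cf w; apply.
pose phi y := f (y + h *: v) - f y.
have dphi (s : R) : s \in `[0, 1]%R ->
    is_derive (x + s *: (h *: u)) (h *: u) phi
     (h * ('D_u f (x + s *: (h *: u) + h *: v) - 'D_u f (x + s *: (h *: u)))).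
  move=> s01; rewrite mulrBr; apply: is_deriveB.
    have d1 : derivable f (x + s *: (h *: u) + h *: v) u.
      by apply: df; have := inr s 1 s01 i1; rewrite scale1r.
    have d2 := is_derive_scale h d1.
    rewrite (_ : h * _ = 'D_(h *: u) f (x + s *: (h *: u) + h *: v)).
      by apply: is_derive_translate; case: d2.
    by case: d2.
  by apply: is_derive_scale; apply: df; have := inr s 0 s01 i0;
    rewrite scale0r addr0.
have [|s s01 sE] := @mvt_line R V phi x (h *: u).
  by move=> s /dphi[].
have s01' := subset_itv_oo_cc s01.
have [_ Df] := cf u.
have [|t t01 tE] := @mvt_line R V ('D_u f) (x + s *: (h *: u)) (h *: v).
  move=> t t01; have [dDf _] := Df (h *: v).
  by apply: dDf; exact: inr.
have bl := inr s t s01' (subset_itv_oo_cc t01).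
exists (x + s *: (h *: u) + t *: (h *: v)) => //.
transitivity (phi (x + h *: u) - phi x).
  by rewrite /phi opprB addrA; ring.
rewrite sE; have [_ ->] := dphi s s01'.
rewrite tE -mulrA; congr (_ * _).
have [dDf _] := Df v.
by have [_ ->] := is_derive_scale h (dDf _ bl).
Qed.

(** The second difference is symmetric in [u] and [v], and it is [h ^+ 2] times
either mixed derivative at some point close to [x]. *)
Lemma schwarz A f x u v : open A -> Ck_on 2 A f -> A x ->
  'D_u ('D_v f) x = 'D_v ('D_u f) x.
Proof.
move=> oA cf Ax; apply/eqP; rewrite -subr_eq0 -normr_le0.
apply/ler_addgt0Pr => e e0; rewrite add0r.
have cuv : {for x, continuous ('D_u ('D_v f))}.
  by have [_ Df] := cf v; have [_] := Df u; apply.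
have cvu : {for x, continuous ('D_v ('D_u f))}.
  by have [_ Df] := cf u; have [_] := Df v; apply.
have e20 : 0 < e / 2 by rewrite divr_gt0.
have /nbhs_ballP[r /= r0 rP] : \forall y \near x,
   [/\ A y, `|'D_u ('D_v f) x - 'D_u ('D_v f) y| < e / 2 &
     `|'D_v ('D_u f) x - 'D_v ('D_u f) y| < e / 2].
  have nA : \forall y \near x, A y by exact: open_nbhs_nbhs.
  have n1 : \forall y \near x, `|'D_u ('D_v f) x - 'D_u ('D_v f) y| < e / 2.
    by move/cvgrPdist_lt : cuv => /(_ _ e20).
  have n2 : \forall y \near x, `|'D_v ('D_u f) x - 'D_v ('D_u f) y| < e / 2.
    by move/cvgrPdist_lt : cvu => /(_ _ e20).
  by apply: filterS3 nA n1 n2 => y.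
have cfr : Ck_on 2 (ball x r) f by apply: Ck_on_sub cf => y /rP[].
(* Small enough for the whole parallelogram spanned by [h u] and [h v] to lie in
   the ball. *)
pose h := r / (`|u| + `|v| + 1).
have d0 : 0 < `|u| + `|v| + 1 by rewrite ltr_wpDl// addr_ge0.
have h0 : 0 < h by rewrite divr_gt0.
have hr w1 w2 : w1 + w2 = `|u| + `|v| -> `|h| * (w1 + w2) < r.
  by move=> ->; rewrite gtr0_norm// /h mulrAC ltr_pdivrMr// ltr_pM2l// ltrDl.
have [y1 /rP[_ _ y1P] E1] := second_difference cfr (hr _ _ erefl).
have [y2 /rP[_ y2P _] E2] := second_difference cfr (hr _ _ (addrC `|v| `|u|)).
have Q : f (x + h *: u + h *: v) - f (x + h *: u) - f (x + h *: v) + f x =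
         f (x + h *: v + h *: u) - f (x + h *: v) - f (x + h *: u) + f x.
  by rewrite [x + _ + h *: u]addrAC (addrAC (f _) (- f (x + h *: v))).
have E : 'D_v ('D_u f) y1 = 'D_u ('D_v f) y2.
  apply: (@mulfI _ (h * h)); first by rewrite mulf_neq0// gt_eqF.
  exact: (etrans (esym E1) (etrans Q E2)).
by rewrite E in y1P; exact: dist_le_split y2P y1P.
Qed.

End Schwarz.

Definition convex_set {R : realType} {V : lmodType R} (K : set V) :=
  forall x y (t : R), K x -> K y -> t \in `[0, 1]%R -> K (x + t *: (y - x)).

Section Estimates.
Context {R : realType} {n : nat}.
Local Notation V := 'rV[R]_n.
Implicit Types (A K : set V) (f : V -> R).

Lemma compact_bound K f : compact K ->
  (forall x, K x -> {for x, continuous f}) ->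
  exists2 C, 0 <= C & forall x, K x -> `|f x| <= C.
Proof.
move=> cK cf.
have : bounded_set (f @` K).
  apply: compact_bounded; apply: continuous_compact => //.
  by apply: continuous_in_subspaceT => x /set_mem; exact: cf.
move=> /pinfty_ex_gt0[M /ltW M0 MP].
by exists M => // x Kx; apply: MP; exists x.
Qed.

Lemma C1_bound A K f : open A -> Ck_on 1 A f -> compact K -> K `<=` A ->
  exists2 C, 0 <= C & forall x v, K x -> `|'D_v f x| <= C * `|v|.
Proof.
move=> oA cf cK KA.
have /choice[c cP] (a : 'I_n) : exists c, 0 <= c /\
    forall x, K x -> `|partial a f x| <= c.
  have [C C0 CP] := @compact_bound K (partial a f) cK
    (fun x Kx => proj2 (cf (delta_mx 0 a)) x (KA x Kx)).
  by exists C.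
exists (\sum_a c a); first by apply: sumr_ge0 => a _; have [] := cP a.
move=> x v Kx; rewrite (C1_deriveE v oA cf (KA _ Kx)) mulr_suml.
apply: (le_trans (ler_norm_sum _ _ _)); apply: ler_sum => a _.
rewrite normrM mulrC ler_pM// ?norm_coord_le//.
by have [_] := cP a; apply.
Qed.

Lemma C1_lipschitz A K f : open A -> Ck_on 1 A f -> compact K -> K `<=` A ->
  convex_set K ->
  exists2 C, 0 <= C & forall x y, K x -> K y -> `|f y - f x| <= C * `|y - x|.
Proof.
move=> oA cf cK KA vK; have [C C0 CP] := C1_bound oA cf cK KA.
exists C => // x y Kx Ky.
have [|t t01 tE] := @mvt_line R V f x (y - x).
  move=> t t01; have [+ _] := cf (y - x); apply; apply: KA; exact: vK.
rewrite [x + _]addrC subrK in tE; rewrite tE; apply: CP.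
by apply: vK => //; exact: subset_itv_oo_cc t01.
Qed.

Lemma C2_scalar A K f : open A -> Ck_on 2 A f -> compact K -> K `<=` A ->
  convex_set K -> exists2 C, 0 <= C &
  forall x y, K x -> K y -> [/\ `|f y - f x| <= C * `|y - x|,
    forall z, `|'D_z f x| <= C * `|z|,
    forall z, `|'D_z f y - 'D_z f x| <= C * `|y - x| * `|z| &
    `|f y - f x - 'D_(y - x) f x| <= C * `|y - x| * `|y - x|].
Proof.
move=> oA cf cK KA vK.
have cf1 : Ck_on 1 A f by exact: Ck_onS.
have [C1 C10 C1P] := C1_bound oA cf1 cK KA.
have [C2 C20 C2P] := C1_lipschitz oA cf1 cK KA vK.
have /choice[c cP] (a : 'I_n) : exists c, 0 <= c /\
    forall x y, K x -> K y -> `|partial a f y - partial a f x| <= c * `|y - x|.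
  have [C C0 CP] := C1_lipschitz oA (proj2 (cf (delta_mx 0 a))) cK KA vK.
  by exists C.
pose C3 := \sum_a c a.
have C30 : 0 <= C3 by apply: sumr_ge0 => a _; have [] := cP a.
have D x y z : K x -> K y -> `|'D_z f y - 'D_z f x| <= C3 * `|y - x| * `|z|.
  move=> Kx Ky; rewrite !(C1_deriveE z oA cf1); [|exact: KA..].
  rewrite -sumrB /C3 mulr_suml mulr_suml.
  apply: (le_trans (ler_norm_sum _ _ _)); apply: ler_sum => a _.
  rewrite -mulrBr normrM mulrC ler_pM// ?norm_coord_le//.
  by have [_] := cP a; apply.
exists (C1 + C2 + C3); first by rewrite !addr_ge0.
move=> x y Kx Ky; split.
- apply: (le_trans (C2P _ _ Kx Ky)); rewrite ler_wpM2r//.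
  by rewrite -addrA addrCA lerDl addr_ge0.
- move=> z; apply: (le_trans (C1P _ _ Kx)); rewrite ler_wpM2r//.
  by rewrite -addrA lerDl addr_ge0.
- move=> z; apply: (le_trans (D _ _ _ Kx Ky)); rewrite !ler_wpM2r//.
  by rewrite lerDr addr_ge0.
have [|t t01 tE] := @mvt_line R V f x (y - x).
  move=> t t01; have [+ _] := cf1 (y - x); apply; apply: KA; exact: vK.
rewrite [x + (y - x)]addrC subrK in tE; rewrite tE.
have t01' := subset_itv_oo_cc t01.
apply: (le_trans (D _ _ _ Kx (vK _ _ _ Kx Ky t01'))); rewrite !ler_wpM2r//.
rewrite addrAC subrr add0r normrZ ler_pM//.
  by rewrite lerDr addr_ge0.
move: t01'; rewrite in_itv/= => /andP[t0 t1].
by rewrite ger0_norm// ler_piMl.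
Qed.

(** These bounds are all that the comparison of solutions of [y' = F y] uses
about [F]; the last one is Taylor's formula with a quadratic remainder. *)
Lemma C2_estimates p (F : V -> 'rV[R]_p) A K : open A ->
  (forall j, Ck_on 2 A (fun x => F x 0 j)) -> compact K -> K `<=` A ->
  convex_set K -> exists2 C, 0 <= C &
  forall x y, K x -> K y -> [/\ `|F y - F x| <= C * `|y - x|,
    forall z, `|'D_z F x| <= C * `|z|,
    forall z, `|'D_z F y - 'D_z F x| <= C * `|y - x| * `|z| &
    `|F y - F x - 'D_(y - x) F x| <= C * `|y - x| * `|y - x|].
Proof.
move=> oA cF cK KA vK.
have /choice[c cP] (j : 'I_p) : exists c, 0 <= c /\
    forall x y, K x -> K y -> [/\ `|F y 0 j - F x 0 j| <= c * `|y - x|,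
    forall z, `|'D_z (fun x => F x 0 j) x| <= c * `|z|,
    forall z, `|'D_z (fun x => F x 0 j) y - 'D_z (fun x => F x 0 j) x|
      <= c * `|y - x| * `|z| &
    `|F y 0 j - F x 0 j - 'D_(y - x) (fun x => F x 0 j) x|
       <= c * `|y - x| * `|y - x|].
  by have [C C0 CP] := C2_scalar oA (cF j) cK KA vK; exists C.
have dF x z j : K x -> ('D_z F x) 0 j = 'D_z (fun x => F x 0 j) x.
  move=> Kx; apply: derive_entry; apply: diff_derivable.
  apply: (C1_mx_differentiable oA) (KA _ Kx) => i k; rewrite ord1.
  by apply: Ck_onS.
have le_c j : c j <= \sum_j c j.
  rewrite (bigD1 j)//= lerDl; apply: sumr_ge0 => k _; by have [] := cP k.
have C0 : 0 <= \sum_j c j by apply: sumr_ge0 => a _; have [] := cP a.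
exists (\sum_j c j) => // x y Kx Ky; split.
- apply: norm_le_coord => [|i j]; first by rewrite mulr_ge0.
  rewrite ord1 !mxE; have [_ /(_ _ _ Kx Ky)[h _ _ _]] := cP j.
  by apply: (le_trans h); rewrite ler_wpM2r.
- move=> z; apply: norm_le_coord => [|i j]; first by rewrite mulr_ge0.
  rewrite ord1 dF//; have [_ /(_ _ _ Kx Ky)[_ h _ _]] := cP j.
  by apply: (le_trans (h z)); rewrite ler_wpM2r.
- move=> z; apply: norm_le_coord => [|i j]; first by rewrite !mulr_ge0.
  rewrite ord1 !mxE !dF//; have [_ /(_ _ _ Kx Ky)[_ _ h _]] := cP j.
  by apply: (le_trans (h z)); rewrite !ler_wpM2r.
- apply: norm_le_coord => [|i j]; first by rewrite !mulr_ge0.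
  rewrite ord1 !mxE dF//; have [_ /(_ _ _ Kx Ky)[_ _ _ h]] := cP j.
  by apply: (le_trans h); rewrite !ler_wpM2r.
Qed.

End Estimates.

(** * Gronwall's inequality and dependence on initial data *)

Section Gronwall.
Context {R : realType} {m : nat}.
Implicit Types w dw : R -> 'rV[R]_m.

Lemma sumsq_ge_norm (v : 'rV[R]_m) : `|v| ^+ 2 <= \sum_k v 0 k ^+ 2.
Proof.
have S0 : 0 <= \sum_k v 0 k ^+ 2 by apply: sumr_ge0 => k _; exact: sqr_ge0.
rewrite -(sqr_sqrtr S0) ler_pXn2r ?nnegrE ?sqrtr_ge0//.
apply: norm_le_coord => [|i k]; first exact: sqrtr_ge0.
rewrite ord1 -sqrtr_sqr ler_wsqrtr// (bigD1 k)//= lerDl.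
by apply: sumr_ge0 => j _; exact: sqr_ge0.
Qed.

Lemma sumsq_le_norm (v : 'rV[R]_m) : \sum_k v 0 k ^+ 2 <= m%:R * `|v| ^+ 2.
Proof.
rewrite mulr_natl -[X in _ *+ X](card_ord m) -sumr_const; apply: ler_sum => k _.
by rewrite -real_normK ?num_real// ler_pXn2r ?nnegrE// norm_coord_le.
Qed.

(** The norm is not differentiable, so it is replaced by the sum of squares
[phi], for which [phi' <= a (phi + be ^+ 2)]; then [(phi + be ^+ 2) exp (- a u)]
decreases.  As intervals have length at most one, [C] depends only on [K] and on
the dimension, hence serves for a whole family of solutions. *)
Lemma gronwall (K : R) : 0 <= K -> exists2 C, 0 <= C &
  forall w dw (p q be : R), p <= q -> q <= p + 1 -> 0 <= be ->
  (forall u, u \in `[p, q]%R -> is_derive u 1 w (dw u)) ->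
  (forall u, u \in `[p, q]%R -> `|dw u| <= K * `|w u| + be) ->
  `|w q| <= C * (`|w p| + be).
Proof.
move=> K0; (* [2 w_k w'_k <= 2 |w| (K |w| + be) <= (2 K + 1) (phi + be ^+ 2)] for each of
   the [m] coordinates. *)
pose a := m%:R * (2 * K + 1).
have a0 : 0 <= a by rewrite mulr_ge0// addr_ge0// mulr_ge0.
pose C := (m%:R + 1) * expR a.
have C0 : 0 <= C by rewrite mulr_ge0// ?expR_ge0// addr_ge0.
exists C => // w dw p q be pq qp be0 dwP wK.
pose phi u := \sum_k w u 0 k ^+ 2.
pose dphi u := \sum_k 2 * (w u 0 k * dw u 0 k).
have dphiP (u : R) : u \in `[p, q]%R -> is_derive u 1 phi (dphi u).
  move=> /dwP d; rewrite (_ : phi = \sum_k (fun u => w u 0 k ^+ 2)); last first.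
    by apply/funext => t; rewrite fct_sumE.
  apply: is_derive_sum => k; have dk := is_derive_mxE 0 k d.
  have dkk : is_derive u 1 (fun u => w u 0 k ^+ 2)
    (w u 0 k *: dw u 0 k + w u 0 k *: dw u 0 k) := is_deriveM dk dk.
  by apply: (is_derive_eq dkk); rewrite mulr_natl mulr2n.
have phi0 u : 0 <= phi u by apply: sumr_ge0 => k _; exact: sqr_ge0.
have dphi_le u : u \in `[p, q]%R -> dphi u <= a * (phi u + be ^+ 2).
  move=> upq; have wu := wK u upq.
  apply: (@le_trans _ _ (\sum_(k < m) (2 * K + 1) * (phi u + be ^+ 2))); last first.
    by rewrite sumr_const card_ord -[leLHS]mulr_natl mulrA.
  apply: ler_sum => k _.
  have h1 : w u 0 k * dw u 0 k <= `|w u| * (K * `|w u| + be).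
    rewrite (le_trans (ler_norm _))// normrM ler_pM// ?norm_coord_le//.
    by rewrite (le_trans _ wu)// norm_coord_le.
  have h2 := sumsq_ge_norm (w u).
  have h3 : 0 <= (`|w u| - be) ^+ 2 by exact: sqr_ge0.
  have h4 : 0 <= K * (phi u - `|w u| ^+ 2) by rewrite mulr_ge0// subr_ge0.
  have h5 : 0 <= K * be ^+ 2 by rewrite mulr_ge0// sqr_ge0.
  rewrite -/(phi u) in h2; nra.
pose e := fun u : R => expR (- a * u).
have de (u : R) : is_derive u 1 e (- a * e u).
  have : is_derive u 1 (expR \o (fun u : R => - a * u)) (expR (- a * u) * (- a)).
    apply: is_derive1_comp.
    have h : is_derive u 1 (fun u : R => - a * u) (- a *: (1 : R)).
      exact: is_deriveZ.
    by apply: (is_derive_eq h); rewrite [LHS]mulr1.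
  by move=> /is_derive_eq; apply; rewrite mulrC.
pose psi u := (phi u + be ^+ 2) * e u.
have dpsi (u : R) : u \in `[p, q]%R ->
    is_derive u 1 psi ((phi u + be ^+ 2) * (- a * e u) + e u * dphi u).
  move=> upq.
  have d1 : is_derive u 1 (fun u => phi u + be ^+ 2) (dphi u).
    rewrite -[dphi u]addr0; apply: is_deriveD; exact: dphiP.
  exact: is_deriveM.
have psi_le : psi q <= psi p.
  apply: (@ler0_derive1_le_cc R psi p q) => //.
  - by move=> u /subset_itv_oo_cc/dpsi[].
  - move=> u /subset_itv_oo_cc u01; rewrite derive1E.
    have [_ ->] := dpsi _ u01.
    rewrite [leLHS](_ : _ = e u * (dphi u - a * (phi u + be ^+ 2))); last by ring.
    rewrite pmulr_rle0 ?expR_gt0//.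
    by have := dphi_le u u01; lra.
  - by apply: derivable_within_continuous => u /dpsi[].
  - by rewrite in_itv/= pq lexx.
  - by rewrite in_itv/= lexx pq.
have E : phi q + be ^+ 2 <= (phi p + be ^+ 2) * expR a.
  have : phi q + be ^+ 2 <= (phi p + be ^+ 2) * (e p / e q).
    by rewrite mulrA ler_pdivlMr ?expR_gt0.
  move/le_trans; apply; rewrite ler_wpM2l ?addr_ge0 ?sqr_ge0//.
  rewrite /e -expRN -expRD ler_expR.
  by have : 0 <= a * (p + 1 - q) by [rewrite mulr_ge0// subr_ge0]; lra.
have h1 := sumsq_ge_norm (w q).
have h2 := sumsq_le_norm (w p).
rewrite -(@ler_pXn2r _ 2) ?nnegrE ?mulr_ge0 ?addr_ge0//.
apply: (le_trans h1); apply: (@le_trans _ _ ((phi p + be ^+ 2) * expR a)).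
  by apply: le_trans E; rewrite lerDl sqr_ge0.
apply: (@le_trans _ _ (C * (`|w p| + be) ^+ 2)).
  rewrite /C mulrAC ler_wpM2r ?expR_ge0//.
  have m0 : 0 <= m%:R :> R by [].
  have h3 : 0 <= `|w p| * be by rewrite mulr_ge0.
  have h4 : 0 <= m%:R * (`|w p| * be) by rewrite mulr_ge0.
  have h5 : 0 <= m%:R * be ^+ 2 by rewrite mulr_ge0 ?sqr_ge0.
  have h6 : 0 <= `|w p| ^+ 2 by exact: sqr_ge0.
  by rewrite -/(phi p) in h2; nra.
rewrite exprMn ler_wpM2r ?sqr_ge0// expr2 ler_peMl//.
have ea : 1 <= expR a by rewrite -expR0 ler_expR.
have m0 : 0 <= m%:R :> R by [].
by rewrite /C; nra.
Qed.

End Gronwall.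

Lemma deriveB_dir {R : realType} {V W : normedModType R} (F : V -> W) x u v :
  differentiable F x -> 'D_(u - v) F x = 'D_u F x - 'D_v F x.
Proof. by move=> dF; rewrite !deriveE// linearB. Qed.

Lemma deriveZ_dir {R : realType} {V W : normedModType R} (F : V -> W) x (a : R) v :
  differentiable F x -> 'D_(a *: v) F x = a *: 'D_v F x.
Proof. by move=> dF; rewrite !deriveE// linearZ. Qed.

Lemma deriveD_dir {R : realType} {V W : normedModType R} (F : V -> W) x u v :
  differentiable F x -> 'D_(u + v) F x = 'D_u F x + 'D_v F x.
Proof. by move=> dF; rewrite !deriveE// linearD. Qed.

(** Each difference satisfies a linear differential inequality: [y1 - y] by the
Lipschitz bound, [z1 - z] up to the error [D_z F (y1) - D_z F (y)], and
[y1 - y - h z] up to the Taylor remainder of [F].  [gronwall] carries the initial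
errors along.  The last estimate contains the differentiability of solutions in
their initial value: if it moves with velocity [z p], then the solution at time
[q] moves with velocity [z q]. *)
Lemma ode_comparison {R : realType} {m : nat} (F : 'rV[R]_m -> 'rV[R]_m)
    (A K : set 'rV[R]_m) : open A ->
  (forall j, Ck_on 2 A (fun x => F x 0 j)) -> compact K -> K `<=` A ->
  convex_set K -> exists2 C, 0 <= C &
  forall (y y1 z z1 : R -> 'rV[R]_m) (p q : R), p <= q -> q <= p + 1 ->
    (forall u, u \in `[p, q]%R -> K (y u)) ->
    (forall u, u \in `[p, q]%R -> K (y1 u)) ->
    (forall u, u \in `[p, q]%R -> is_derive u 1 y (F (y u))) ->
    (forall u, u \in `[p, q]%R -> is_derive u 1 y1 (F (y1 u))) ->
    (forall u, u \in `[p, q]%R -> is_derive u 1 z ('D_(z u) F (y u))) ->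
    (forall u, u \in `[p, q]%R -> is_derive u 1 z1 ('D_(z1 u) F (y1 u))) ->
  [/\ `|y1 q - y q| <= C * `|y1 p - y p|,
      `|z1 q - z q| <= C * (`|z1 p - z p| + `|y1 p - y p| * `|z p|) &
      forall h : R, `|y1 q - y q - h *: z q| <=
        C * (`|y1 p - y p - h *: z p| + `|y1 p - y p| ^+ 2)].
Proof.
move=> oA cF cK KA vK.
have [K1 K10 KP] := C2_estimates oA cF cK KA vK.
have dF x : K x -> differentiable F x.
  move=> /KA; apply: (C1_mx_differentiable oA) => i j; rewrite ord1.
  exact: Ck_onS.
have [G G0 GP] := @gronwall R m K1 K10.
exists (G * (1 + K1 * G * G)).
  by rewrite mulr_ge0// addr_ge0// !mulr_ge0.
move=> y y1 z z1 p q pq qp yK y1K dy dy1 dz dz1.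
have sub u v : u \in `[p, q]%R -> v \in `[p, u]%R -> v \in `[p, q]%R.
  rewrite !in_itv/= => /andP[pu uq] /andP[pv vu].
  by rewrite pv (le_trans vu uq).
have pu1 u : u \in `[p, q]%R -> p <= u /\ u <= p + 1.
  by rewrite in_itv/= => /andP[pu uq]; rewrite pu (le_trans uq qp).
have Y u : u \in `[p, q]%R -> `|y1 u - y u| <= G * `|y1 p - y p|.
  move=> upq; have [pu up] := pu1 u upq.
  have D1 v : v \in `[p, u]%R ->
      is_derive v 1 (fun t => y1 t - y t) (F (y1 v) - F (y v)).
    by move=> /(sub _ _ upq) vpq; apply: is_deriveB; [exact: dy1|exact: dy].
  have D2 v : v \in `[p, u]%R ->
      `|F (y1 v) - F (y v)| <= K1 * `|y1 v - y v| + 0.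
    move=> /(sub _ _ upq) vpq; rewrite addr0.
    by have [] := KP _ _ (yK v vpq) (y1K v vpq).
  by have := GP _ _ p u 0 pu up (lexx 0) D1 D2; rewrite addr0.
have Z u : u \in `[p, q]%R -> `|z u| <= G * `|z p|.
  move=> upq; have [pu up] := pu1 u upq.
  have D1 v : v \in `[p, u]%R -> is_derive v 1 z ('D_(z v) F (y v)).
    by move=> /(sub _ _ upq) vpq; exact: dz.
  have D2 v : v \in `[p, u]%R -> `|'D_(z v) F (y v)| <= K1 * `|z v| + 0.
    move=> /(sub _ _ upq) vpq; rewrite addr0.
    by have [_ + _ _] := KP _ _ (yK v vpq) (y1K v vpq); apply.
  by have := GP _ _ p u 0 pu up (lexx 0) D1 D2; rewrite addr0.
have qpq : q \in `[p, q]%R by rewrite in_itv/= pq lexx.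
have le1 (s t : R) : 0 <= s -> 0 <= t ->
    G * (s + K1 * G * G * t) <= G * (1 + K1 * G * G) * (s + t).
  move=> s0 t0; rewrite -[leRHS]mulrA ler_wpM2l// mulrDl mul1r mulrDr.
  have k0 : 0 <= K1 * G * G by rewrite !mulr_ge0.
  by have k1 : 0 <= K1 * G * G * s by [rewrite mulr_ge0]; lra.
split.
- apply: (le_trans (Y q qpq)); rewrite ler_wpM2r// ler_peMr//.
  by rewrite lerDl !mulr_ge0.
- apply: (@le_trans _ _ (G * (`|z1 p - z p| +
      K1 * G * G * (`|y1 p - y p| * `|z p|)))); last by apply: le1; rewrite ?mulr_ge0.
  apply: (GP (fun t => z1 t - z t)
    (fun t => 'D_(z1 t) F (y1 t) - 'D_(z t) F (y t)) p q _ pq qp).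
  + by rewrite !mulr_ge0.
  + by move=> v vpq; apply: is_deriveB; [exact: dz1|exact: dz].
  + move=> v vpq; rewrite -(subrKA ('D_(z v) F (y1 v))).
    apply: (le_trans (ler_normD _ _)); apply: lerD.
      rewrite -deriveB_dir; last by apply: dF; exact: y1K.
      by have [_ + _ _] := KP _ _ (y1K v vpq) (yK v vpq); apply.
    have [_ _ + _] := KP _ _ (yK v vpq) (y1K v vpq).
    move=> /(_ (z v)) /le_trans; apply.
    rewrite -!mulrA ler_wpM2l//.
    have -> : G * (G * (`|y1 p - y p| * `|z p|)) =
      (G * `|y1 p - y p|) * (G * `|z p|) by ring.
    by apply: ler_pM; [| |exact: Y|exact: Z].
- move=> h.
  apply: (@le_trans _ _ (G * (`|y1 p - y p - h *: z p| +
      K1 * G * G * `|y1 p - y p| ^+ 2))); last first.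
    by apply: le1; rewrite ?sqr_ge0.
  apply: (GP (fun t => y1 t - y t - h *: z t)
    (fun t => F (y1 t) - F (y t) - h *: 'D_(z t) F (y t)) p q _ pq qp).
  + by rewrite !mulr_ge0.
  + move=> v vpq; apply: is_deriveB; last by apply: is_deriveZ; exact: dz.
    by apply: is_deriveB; [exact: dy1|exact: dy].
  + move=> v vpq; have [_ _ _ h4] := KP _ _ (yK v vpq) (y1K v vpq).
    have dFv := dF _ (yK v vpq).
    rewrite -deriveZ_dir//.
    rewrite (_ : F (y1 v) - F (y v) - 'D_(h *: z v) F (y v) =
      (F (y1 v) - F (y v) - 'D_(y1 v - y v) F (y v)) +
      'D_(y1 v - y v - h *: z v) F (y v)); last first.
      by rewrite (deriveB_dir (y1 v - y v))// addrA subrK.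
    rewrite addrC; apply: (le_trans (ler_normD _ _)); apply: lerD.
      by have [_ + _ _] := KP _ _ (yK v vpq) (y1K v vpq); apply.
    apply: (le_trans h4).
    have -> : K1 * G * G * `|y1 p - y p| ^+ 2 =
      K1 * (G * `|y1 p - y p|) * (G * `|y1 p - y p|) by ring.
    apply: ler_pM; rewrite ?mulr_ge0//; last exact: Y.
    by rewrite ler_wpM2l//; exact: Y.
Qed.

(** * Limits and expansions along a set of parameters *)

Section MatrixLimits.
Context {R : realType} {m p : nat}.

Lemma cvg_mx {T : Type} (F : set_system T) {FF : Filter F}
    (f : T -> 'M[R]_(m, p)) (l : 'M[R]_(m, p)) :
  (forall i j, f x i j @[x --> F] --> l i j) -> f x @[x --> F] --> l.
Proof.
move=> fl; apply/cvgrPdist_le => e e0.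
have : \forall x \near F, forall ij : 'I_m * 'I_p,
    `|l ij.1 ij.2 - f x ij.1 ij.2| <= e.
  apply: filter_forall => -[i j] /=.
  by have /cvgrPdist_le/(_ _ e0) := fl i j.
apply: filterS => x fx; apply: norm_le_coord; first exact: ltW.
by move=> i j; rewrite !mxE; have := fx (i, j).
Qed.

Lemma cvg_entry {T : Type} (F : set_system T) {FF : Filter F}
    (f : T -> 'M[R]_(m, p)) (l : 'M[R]_(m, p)) i j :
  f x @[x --> F] --> l -> f x i j @[x --> F] --> l i j.
Proof.
by move=> fl; exact: (cvg_comp _ _ fl (@coord_continuous _ _ _ i j _)).
Qed.

Lemma is_derive_mx (U : normedModType R) (G : U -> 'M[R]_(m, p)) x v
    (dG : 'M[R]_(m, p)) :
  (forall i j, is_derive x v (fun y => G y i j) (dG i j)) ->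
  is_derive x v G dG.
Proof.
move=> h; have d : derivable G x v.
  by apply/derivable_mxP => i j; have [] := h i j.
apply: DeriveDef => //; rewrite derive_mx//; apply/matrixP => i j.
by rewrite mxE; have [_ ->] := h i j.
Qed.

End MatrixLimits.

Lemma is_derive_row_mx {R : realType} {m1 m2 : nat} (U : normedModType R)
    (f : U -> 'rV[R]_m1) (g : U -> 'rV[R]_m2) x v
    (df : 'rV[R]_m1) (dg : 'rV[R]_m2) :
  is_derive x v f df -> is_derive x v g dg ->
  is_derive x v (fun y => row_mx (f y) (g y)) (row_mx df dg).
Proof.
move=> hf hg; apply: is_derive_mx => i j; rewrite mxE ord1.
under eq_fun do rewrite mxE.
by case: split_ordP => k _; exact: is_derive_mxE.
Qed.

Section Submatrices.
Context {R : realType} {n : nat}.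

Lemma lsubmx_continuous : continuous (@lsubmx R 1 n n).
Proof.
move=> y; apply: (@cvg_mx _ _ _ _ (nbhs y)) => i j; rewrite mxE.
under eq_fun do rewrite mxE; exact: coord_continuous.
Qed.

Lemma rsubmx_continuous : continuous (@rsubmx R 1 n n).
Proof.
move=> y; apply: (@cvg_mx _ _ _ _ (nbhs y)) => i j; rewrite mxE.
under eq_fun do rewrite mxE; exact: coord_continuous.
Qed.

Lemma norm_row_mx_le (a b : 'rV[R]_n) (e : R) : `|a| <= e -> `|b| <= e ->
  `|row_mx a b| <= e.
Proof.
move=> ae be; apply: norm_le_coord => [|i j]; first by rewrite (le_trans _ ae).
rewrite mxE ord1; case: split_ordP => k _.
  by rewrite (le_trans _ ae)// norm_coord_le.
by rewrite (le_trans _ be)// norm_coord_le.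
Qed.

End Submatrices.

Section Expansion.
Context {R : realType}.
Variables (D : set R) (s0 : R).

(** Differentiability at [s0] relative to [D]: the parameters of the poles form a
closed interval, whose end points are to be treated like the others. *)
Definition expands (W : normedModType R) (f : R -> W) (d : W) : Prop :=
  forall e : R, 0 < e -> \forall s \near within D (nbhs s0),
    `|f s - f s0 - (s - s0) *: d| <= e * `|s - s0|.

Lemma expands_cvg (W : normedModType R) (f : R -> W) d :
  expands f d -> f s @[s --> within D (nbhs s0)] --> f s0.
Proof.
move=> fd; apply/cvgrPdist_le => e e0.
have k0 : 0 < 1 + `|d| by rewrite ltr_pwDl.
have n1 : \forall s \near within D (nbhs s0), `|s - s0| <= e / (1 + `|d|).
  apply: cvg_within; apply/nbhs_ballP; exists (e / (1 + `|d|)).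
    by rewrite /= divr_gt0.
  by move=> s /=; rewrite -ball_normE /ball_/= distrC => /ltW.
apply: filterS2 (fd 1 ltr01) n1 => s h1 h2.
rewrite distrC -(subrK ((s - s0) *: d) (f s - f s0)).
apply: (le_trans (ler_normD _ _)); rewrite normrZ.
rewrite ler_pdivlMr// in h2; apply: le_trans h2; rewrite mulrDr mulr1.
by rewrite lerD2r; rewrite mul1r in h1.
Qed.

Lemma expands_near_eq (W : normedModType R) (f h : R -> W) d : f s0 = h s0 ->
  (\forall s \near within D (nbhs s0), f s = h s) -> expands f d -> expands h d.
Proof.
move=> E nE fd e e0; apply: filterS2 nE (fd e e0) => s <-.
by rewrite E.
Qed.

Lemma is_derive_expands (W : normedModType R) (f : R -> W) d :
  is_derive s0 1 f d -> expands f d.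
Proof.
move=> [df dE] e e0; apply: cvg_within.
have h : (fun h => h^-1 *: ((f \o shift s0) (h *: (1 : R)) - f s0)) h @[h --> 0^'] --> d.
  by rewrite -dE; exact: df.
have /cvgrPdist_le/(_ _ e0) := h.
rewrite /dnbhs => /nbhs_ballP[r /= r0 rP].
apply/nbhs_ballP; exists r => //= s sr.
have [->|ss0] := eqVneq s s0; first by rewrite !subrr scale0r subr0 !normr0 mulr0.
have s0' : s - s0 != 0 by rewrite subr_eq0.
have /rP/(_ s0') : ball 0 r (s - s0).
  by rewrite -ball_normE /ball_/= sub0r opprB; move: sr; rewrite -ball_normE.
rewrite /= [(s - s0)%:A]mulr1 subrK => H.
rewrite -ler_pdivrMr ?normr_gt0// -normfV mulrC -normrZ scalerBr.
by rewrite scalerA mulVf// scale1r distrC.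
Qed.

Lemma expands_is_derive (W : normedModType R) (f : R -> W) d :
  nbhs s0 D -> expands f d -> is_derive s0 1 f d.
Proof.
move=> nD fd.
suff h : (fun h => h^-1 *: ((f \o shift s0) (h *: (1 : R)) - f s0)) h @[h --> 0^'] --> d.
  apply: DeriveDef; first by apply/cvg_ex; exists d.
  exact: cvg_lim h.
apply/cvgrPdist_le => e e0.
have := fd e e0; rewrite near_withinE => fe.
have /nbhs_ballP[r /= r0 rP] : \forall s \near s0,
    `|f s - f s0 - (s - s0) *: d| <= e * `|s - s0|.
  by apply: filterS2 nD fe => s Ds; apply.
near=> h.
have h0 : h != 0 by near: h; exact: nbhs_dnbhs_neq.
have hr : `|h| < r by near: h; exact: dnbhs0_lt.
have /rP : ball s0 r (h + s0).
  by rewrite -ball_normE /ball_/= opprD addrCA subrr addr0 normrN.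
rewrite addrK => H; rewrite /= [h%:A]mulr1.
move: H; rewrite -ler_pdivrMr ?normr_gt0// -normfV mulrC -normrZ scalerBr.
by rewrite scalerA mulVf// scale1r distrC.
Unshelve. all: by end_near. Qed.

Lemma expands_comp (V W : normedModType R) (F : V -> W) (f : R -> V) d :
  differentiable F (f s0) -> expands f d ->
  expands (F \o f) ('D_d F (f s0)).
Proof.
move=> dF fd e e0.
have [M M0 MP] : exists2 M : R, 0 < M & forall v, `|'d F (f s0) v| <= M * `|v|.
  have [k k0 kP] := linear_lipschitz (diff_continuous dF).
  by exists k => //.
pose k := `|d| + 1; have k0 : 0 < k by rewrite ltr_wpDl.
have e1 : 0 < e / 2 / k by rewrite !divr_gt0.
have e2 : 0 < e / 2 / M by rewrite !divr_gt0.
have n1 : \forall v \near (0 : V),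
    `|F (v + f s0) - F (f s0) - 'd F (f s0) v| <= e / 2 / k * `|v|.
  have /diff_locallyxP[_ H] := dF.
  have /eqaddoP/(_ _ e1) : F \o shift (f s0) = cst (F (f s0)) + 'd F (f s0) +o_ (0 : V) id.
    by have /diff_locallyP[] := dF.
  by apply: filterS => v; rewrite /= !fctE/= opprD addrA.
have n2 : \forall s \near within D (nbhs s0),
    `|F (f s - f s0 + f s0) - F (f s0) - 'd F (f s0) (f s - f s0)|
       <= e / 2 / k * `|f s - f s0|.
  have c : f s - f s0 @[s --> within D (nbhs s0)] --> (0 : V).
    by apply/subr_cvg0; exact: expands_cvg fd.
  exact: (c _ n1).
apply: filterS3 n2 (fd _ e2) (fd _ ltr01) => s; rewrite subrK => h1 h2 h3.
rewrite /= deriveE//.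
rewrite (_ : _ - _ = (F (f s) - F (f s0) - 'd F (f s0) (f s - f s0)) +
   'd F (f s0) (f s - f s0 - (s - s0) *: d)); last first.
  have L w : 'd F (f s0) (w - (s - s0) *: d) =
    'd F (f s0) w - (s - s0) *: 'd F (f s0) d by rewrite linearB linearZ.
  by rewrite L addrA subrK.
apply: (le_trans (ler_normD _ _)); rewrite [e in leRHS]splitr mulrDl lerD//.
  have e20 : 0 <= e / 2 by rewrite divr_ge0// ltW.
  apply: (le_trans h1); rewrite -mulrA ler_wpM2l//.
  rewrite mulrC ler_pdivrMr// mulrC /k mulrDl mul1r.
  rewrite -{1}(subrK ((s - s0) *: d) (f s - f s0)).
  apply: (le_trans (ler_normD _ _)); rewrite normrZ addrC lerD//.
    by rewrite mulrC.
  by rewrite mul1r in h3.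
apply: (le_trans (MP _)); rewrite mulrC -ler_pdivlMr//.
by apply: (le_trans h2); rewrite mulrAC.
Qed.

End Expansion.

Lemma cvg_derive {R : realType} {m p : nat} {T : Type} (F : set_system T)
    {FF : Filter F} (A : set 'rV[R]_m) (Phi : 'rV[R]_m -> 'rV[R]_p)
    (y z : T -> 'rV[R]_m) (y0 z0 : 'rV[R]_m) : open A ->
  (forall j, Ck_on 1 A (fun x => Phi x 0 j)) -> A y0 ->
  y s @[s --> F] --> y0 -> z s @[s --> F] --> z0 ->
  'D_(z s) Phi (y s) @[s --> F] --> 'D_z0 Phi y0.
Proof.
move=> oA cP Ay yc zc.
have E x w j : A x -> ('D_w Phi x) 0 j =
    \sum_e w 0 e * partial e (fun x => Phi x 0 j) x.
  move=> Ax; rewrite derive_entry; first exact: C1_deriveE (cP j) Ax.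
  apply: diff_derivable; apply: (C1_mx_differentiable oA) Ax => i k.
  by rewrite ord1.
have nA : \forall s \near F, A (y s).
  by apply: (yc A); exact: open_nbhs_nbhs.
apply: cvg_mx => i j; rewrite ord1 (E _ _ _ Ay).
have c : \sum_e z s 0 e * partial e (fun x => Phi x 0 j) (y s) @[s --> F] -->
    \sum_e z0 0 e * partial e (fun x => Phi x 0 j) y0.
  apply: cvg_sum => e _; apply: cvgM; first exact: cvg_entry.
  apply: (cvg_comp _ _ yc).
  by have [_] := cP j (delta_mx 0 e); apply.
apply: (cvg_trans _ c); apply: near_eq_cvg.
by apply: filterS nA => s Ays; rewrite E.
Qed.

(** * Charts and the geodesic vector field *)

Section Charts.
Context {R : realType} {n : nat} {M : manifold R n}.
Implicit Types (i j : chart M) (p : M).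

Definition chart_range i : set 'rV[R]_n := chart_map i @` dom i.
Definition overlap i j : set 'rV[R]_n := chart_map i @` (dom i `&` dom j).
Definition transition i j : 'rV[R]_n -> 'rV[R]_n := chart_map j \o chart_inv i.

Lemma range_map i p : dom i p -> chart_range i (chart_map i p).
Proof. by move=> ip; exists p. Qed.

Lemma range_inv i x : chart_range i x ->
  dom i (chart_inv i x) /\ chart_map i (chart_inv i x) = x.
Proof. by move=> [p ip <-]; rewrite chart_mapK. Qed.

Lemma overlapP i j x :
  overlap i j x <-> chart_range i x /\ dom j (chart_inv i x).
Proof.
split=> [[p [ip jp] <-]|[[p ip <-]]].
  by rewrite chart_mapK//; split => //; exists p.
by rewrite chart_mapK// => jp; exists p.
Qed.

Lemma overlap_open i j : open (overlap i j).
Proof.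
rewrite openE => x /overlapP[xi xj]; rewrite /interior.
have n1 : nbhs x (chart_range i) by apply: open_nbhs_nbhs; split => //; exact: range_open.
have n2 : nbhs x (chart_inv i @^-1` dom j).
  apply: (chart_inv_continuous xi).
  by apply: open_nbhs_nbhs; split => //; exact: dom_open.
by apply: filterS2 n1 n2 => y yi yj; apply/overlapP.
Qed.

Lemma transition_entry_smooth k i j b :
  Ck_on k (overlap i j) (fun x => transition i j x 0 b).
Proof.
apply: Ck_on_entry; first exact: overlap_open.
exact: transition_smooth.
Qed.

Lemma transition_differentiable i j x : overlap i j x ->
  differentiable (transition i j) x.
Proof.
apply: (C1_mx_differentiable (@overlap_open i j)) => a b; rewrite ord1.
exact: transition_entry_smooth.
Qed.

Lemma transition_map i j p : dom i p ->
  transition i j (chart_map i p) = chart_map j p.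
Proof. by move=> ip; rewrite /transition /= chart_mapK. Qed.

Lemma change_mxE i j p a b : dom i p -> dom j p ->
  change_mx i j p a b =
  partial a (fun x => transition i j x 0 b) (chart_map i p).
Proof.
move=> ip jp; rewrite /change_mx jacobian_entry//.
by apply: transition_differentiable; exists p.
Qed.

End Charts.

Section GeodesicField.
Context {R : realType} {n : nat} {M : manifold R n} (g : riemannian_metric M).
Implicit Types (i j : chart M).
Local Notation V := 'rV[R]_n.

Lemma gram_entry_smooth k i a b : Ck_on k (chart_range i) (fun x => g i x a b).
Proof. by apply: Ck_on_entry; [exact: range_open|exact: gram_smooth]. Qed.

Lemma Ck_on_partial k (A : set V) (f : V -> R) e :
  Ck_on k.+1 A f -> Ck_on k A (partial e f).
Proof. by move=> cf; have [] := cf (delta_mx 0 e). Qed.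

Lemma det_smooth k m (A : set V) (F : V -> 'M[R]_m) : open A ->
  (forall a b, Ck_on k A (fun x => F x a b)) -> Ck_on k A (fun x => \det (F x)).
Proof.
move=> oA cF; apply: Ck_on_sum => // s; apply: Ck_onZ => //.
exact: Ck_on_prod.
Qed.

(** By Cramer's rule, the entries of the inverse are cofactors divided by the
determinant. *)
Lemma invmx_smooth k m (A : set V) (F : V -> 'M[R]_m) : open A ->
  (forall x, A x -> F x \in unitmx) ->
  (forall a b, Ck_on k A (fun x => F x a b)) ->
  forall a b, Ck_on k A (fun x => invmx (F x) a b).
Proof.
move=> oA uF cF a b.
apply: (@Ck_on_eq _ _ _ _ _ (fun x => (\det (F x))^-1 * cofactor (F x) b a)) => //.
  by move=> x Ax; rewrite /invmx (uF _ Ax) mxE mxE.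
apply: Ck_onM => //.
  apply: Ck_onV => //; last exact: det_smooth.
  by move=> x /uF; rewrite unitmxE unitfE.
apply: Ck_onZ => //; apply: det_smooth => // c d.
apply: (@Ck_on_eq _ _ _ _ _ (fun x => F x (lift b c) (lift a d))) => //.
by move=> x _; rewrite !mxE.
Qed.

Lemma christoffel_smooth k i d a b : Ck_on k (chart_range i) (christoffel g i d a b).
Proof.
have oA : open (chart_range i) by exact: range_open.
apply: Ck_onZ => //; apply: Ck_on_sum => // e; apply: Ck_onM => //.
  apply: invmx_smooth => //; last by move=> *; exact: gram_entry_smooth.
  by move=> x [p ip <-]; exact: gram_unit.
by apply: Ck_onB => //; first apply: Ck_onD => //; apply: Ck_on_partial;
  exact: gram_entry_smooth.
Qed.

(** The components of [gam x u v] are [Gamma^d_{ab} u^a v^b], so the geodesic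
equation reads [x'' + gam x x' x' = 0]. *)
Definition gam i (x u v : V) : V :=
  \row_d \sum_a \sum_b christoffel g i d a b x * u 0 a * v 0 b.

(** The derivative of [gam] in the base point, along [w]. *)
Definition dgam i (x w u v : V) : V :=
  \row_d \sum_a \sum_b 'D_w (christoffel g i d a b) x * u 0 a * v 0 b.

(** The geodesic spray, in the coordinates [(x, x')] of the tangent bundle. *)
Definition geofield i (y : 'rV[R]_(n + n)) : 'rV[R]_(n + n) :=
  row_mx (rsubmx y) (- gam i (lsubmx y) (rsubmx y) (rsubmx y)).

Definition phase_range i : set 'rV[R]_(n + n) := lsubmx @^-1` chart_range i.

Lemma phase_range_open i : open (phase_range i).
Proof.
by apply: open_comp; [move=> y _; exact: lsubmx_continuous|exact: range_open].
Qed.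

Lemma Ck_on_lsubmx k (A : set V) (f : V -> R) : Ck_on k A f ->
  Ck_on k (lsubmx @^-1` A) (fun y : 'rV[R]_(n + n) => f (lsubmx y)).
Proof. move=> cf; apply: (Ck_on_linear _ cf); exact: lsubmx_continuous. Qed.

Lemma geofield_smooth k i (j : 'I_(n + n)) :
  Ck_on k (phase_range i) (fun y => geofield i y 0 j).
Proof.
have oA := @phase_range_open i.
case: (split_ordP j) => a ->{j}.
  apply: (@Ck_on_eq _ _ _ _ _ (fun y : 'rV[R]_(n + n) => y 0 (rshift n a))) => //.
    by move=> y _; rewrite row_mxEl mxE.
  exact: Ck_on_coord.
apply: (@Ck_on_eq _ _ _ _ _ (fun y : 'rV[R]_(n + n) => - \sum_c \sum_b
    christoffel g i a c b (lsubmx y) * y 0 (rshift n c) * y 0 (rshift n b))) => //.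
  move=> y _; rewrite row_mxEr !mxE; congr (- _); apply: eq_bigr => c _.
  by apply: eq_bigr => b _; rewrite !mxE.
apply: Ck_onN => //; apply: Ck_on_sum => // c; apply: Ck_on_sum => // b.
apply: Ck_onM => //; last exact: Ck_on_coord.
apply: Ck_onM => //; last exact: Ck_on_coord.
by apply: Ck_on_lsubmx; exact: christoffel_smooth.
Qed.

Lemma geofield_differentiable i y : phase_range i y ->
  differentiable (geofield i) y.
Proof.
apply: (C1_mx_differentiable (@phase_range_open i)) => a b; rewrite ord1.
exact: geofield_smooth.
Qed.

Lemma is_derive_gam i (x u v : R -> V) (t : R) (dx du dv : V) :
  chart_range i (x t) -> is_derive t 1 x dx -> is_derive t 1 u du ->
  is_derive t 1 v dv ->
  is_derive t 1 (fun r => gam i (x r) (u r) (v r))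
   (dgam i (x t) dx (u t) (v t) + gam i (x t) du (v t) + gam i (x t) (u t) dv).
Proof.
move=> xt hx hu hv; apply: is_derive_mx => z d; rewrite {z}ord1.
under eq_fun do rewrite mxE.
rewrite (_ : (fun _ => _) = \sum_a \sum_b (fun r =>
  christoffel g i d a b (x r) * u r 0 a * v r 0 b)); last first.
  by apply/funext => r; rewrite fct_sumE; apply: eq_bigr => a _; rewrite fct_sumE.
rewrite !mxE -!big_split/=; apply: is_derive_sum => a.
rewrite -!big_split/=; apply: is_derive_sum => b.
have hG : is_derive t 1 (fun r => christoffel g i d a b (x r))
    ('D_dx (christoffel g i d a b) (x t)).
  apply: (@chain_curve _ _ _ x (christoffel g i d a b)) => //.
  apply: C1_differentiable (xt); first exact: range_open.
  exact: christoffel_smooth.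
have hua := is_derive_mxE 0 a hu; have hvb := is_derive_mxE 0 b hv.
have h1 : is_derive t 1 (fun r => christoffel g i d a b (x r) * u r 0 a)
  (christoffel g i d a b (x t) *: du 0 a +
     u t 0 a *: 'D_dx (christoffel g i d a b) (x t)) := is_deriveM hG hua.
have h2 : is_derive t 1
    (fun r => christoffel g i d a b (x r) * u r 0 a * v r 0 b) _ :=
  is_deriveM h1 hvb.
apply: (is_derive_eq h2).
have sE (p q : R) : p *: q = p * q by [].
by rewrite !sE; ring.
Qed.

Lemma derive_geofield i (y z : 'rV[R]_(n + n)) : phase_range i y ->
  'D_z (geofield i) y = row_mx (rsubmx z)
    (- (dgam i (lsubmx y) (lsubmx z) (rsubmx y) (rsubmx y)
     + gam i (lsubmx y) (rsubmx z) (rsubmx y)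
     + gam i (lsubmx y) (rsubmx y) (rsubmx z))).
Proof.
move=> iy.
have d : derivable (geofield i) (y + 0 *: z) z.
  by rewrite scale0r addr0; apply: diff_derivable; exact: geofield_differentiable.
have [_] := is_derive_line d; rewrite scale0r addr0 => <-.
have lin (L : {linear 'rV[R]_(n + n) -> V}) :
    is_derive (0 : R) 1 (fun r => L (y + r *: z)) (L z).
  rewrite (_ : (fun _ => _) = cst (L y) + (fun r : R => r *: L z)); last first.
    by apply/funext => r; rewrite linearD linearZ.
  have h : is_derive (0 : R) 1 (fun r : R => r *: L z) (L z).
    have h : is_derive (0 : R) 1 (fun r : R => r *: L z)
        ('D_1 (fun r : R => r *: L z) 0).
      by apply: derivableP; apply/derivable1_diffP; exact: differentiableZl.
    apply: (is_derive_eq h); rewrite deriveE; last exact: differentiableZl.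
    by rewrite diffZl// diff_val scale1r.
  have h0 : is_derive (0 : R) 1 (cst (L y)) (0 : V) by exact: is_derive_cst.
  have h1 := is_deriveD h0 h; rewrite add0r in h1; exact: h1.
have hl := lin (@lsubmx R 1 n n); have hr := lin (@rsubmx R 1 n n).
have y0 : y + 0 *: z = y by rewrite scale0r addr0.
have xt : chart_range i (lsubmx (y + 0 *: z)) by rewrite y0.
have hG := is_derive_gam xt hl hr hr.
have [_ H] := is_derive_row_mx hr (is_deriveN hG).
by rewrite [LHS]H /= y0.
Qed.

End GeodesicField.

(** * Curves and the linearized geodesic equation *)

Section SmoothPaths.
Context {R : realType} {W : normedModType R}.
Implicit Types (O : set R) (f : R -> W).

Lemma smooth_is_derive O f (t : R) : smooth_on O f -> O t ->
  is_derive t 1 f (derive1 f t).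
Proof.
move=> sf Ot; rewrite derive1E; apply: derivableP.
exact: smooth_on_derivable sf Ot.
Qed.

Lemma smooth_derive1 O f : smooth_on O f -> smooth_on O (derive1 f).
Proof.
move=> sf; rewrite (_ : (derive1 f) = 'D_1 f); first exact: smooth_on_derive.
by apply/funext => t; rewrite derive1E.
Qed.

End SmoothPaths.

Section CurvesInCharts.
Context {R : realType} {n : nat} {M : manifold R n} (g : riemannian_metric M).
Implicit Types (i j : chart M) (c : R -> M) (X Y Z : vfield M).

Definition phase c i (u : R) : 'rV[R]_(n + n) :=
  row_mx (chart_map i (c u)) (velocity c i u).

(** If geodesics vary with variation field [Z], their phase points vary with
velocity [(Z, Z')]. *)
Definition lift Z i (u : R) : 'rV[R]_(n + n) :=
  row_mx (Z i u) (derive1 (Z i) u).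

(** The equation obtained by differentiating [y' = geofield y] with respect to a
parameter.  It is written with ordinary derivatives in charts, the form in which
solutions can be compared. *)
Definition linearized c Z : Prop :=
  smooth_vfield_along c Z /\
  forall (u : R) i, dom i (c u) ->
    is_derive u 1 (lift Z i) ('D_(lift Z i u) (geofield g i) (phase c i u)).

Lemma curve_dom_open (A : set R) c i : smooth_curve A c ->
  open (A `&` c @^-1` dom i).
Proof.
move=> [oA cc _]; rewrite openE => t [At ct]; rewrite /interior.
have n1 : nbhs t A by exact: open_nbhs_nbhs.
have n2 : nbhs t (c @^-1` dom i).
  by apply: (cc t At); apply: open_nbhs_nbhs; split => //; exact: dom_open.
by apply: filterS2 n1 n2 => s.
Qed.

Lemma chart_is_derive (A : set R) c i t : smooth_curve A c -> A t ->
  dom i (c t) -> is_derive t 1 (chart_map i \o c) (velocity c i t).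
Proof. by move=> [_ _ sc] At ct; apply: (smooth_is_derive (sc i)). Qed.

Lemma velocity_is_derive (A : set R) c i t : smooth_curve A c -> A t ->
  dom i (c t) -> is_derive t 1 (velocity c i) (derive1 (velocity c i) t).
Proof.
move=> [_ _ sc] At ct.
exact: (smooth_is_derive (smooth_derive1 (sc i))).
Qed.

(** The two coordinate expressions of [c] differ by the transition map, and the
chain rule applies. *)
Lemma velocity_change (A : set R) c i j t : smooth_curve A c -> A t ->
  dom i (c t) -> dom j (c t) ->
  velocity c j t = velocity c i t *m change_mx i j (c t).
Proof.
move=> sc At it jt.
have dT : differentiable (transition i j) (chart_map i (c t)).
  by apply: transition_differentiable; exists (c t).
have h := chain_curve (chart_is_derive sc At it) dT.
have oi : \forall s \near t, transition i j (chart_map i (c s)) = chart_map j (c s).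
  have := open_nbhs_nbhs (conj (curve_dom_open (i := i) sc) (conj At it)).
  by apply: filterS => s [_ si]; rewrite transition_map.
have h2 : is_derive t 1 (chart_map j \o c) _ := near_eq_is_derive oi h.
have [_ <-] := chart_is_derive sc At jt.
have [_ ->] := h2.
by rewrite deriveEjacobian.
Qed.

Lemma velocity_vfield c : smooth_curve setT c ->
  smooth_vfield_along c (velocity c).
Proof.
move=> sc; split; first by move=> t i j; exact: (velocity_change sc).
by move=> i; apply: smooth_derive1; have [_ _ /(_ i)] := sc; rewrite setTI.
Qed.

(** [inner] is computed in a chosen chart; by [gram_change] any chart around the
point gives the same value. *)
Lemma innerE c X Y t i : dom i (c t) ->
  (forall j, dom j (c t) -> X j t = X i t *m change_mx i j (c t)) ->
  (forall j, dom j (c t) -> Y j t = Y i t *m change_mx i j (c t)) ->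
  inner g c X Y t = (X i t *m g i (chart_map i (c t)) *m (Y i t)^T) 0 0.
Proof.
move=> it hX hY; rewrite /inner; set j := chart_at (c t).
have jt : dom j (c t) by rewrite /j /chart_at; case: cid.
by rewrite (hX _ jt) (hY _ jt) (gram_change g it jt) trmx_mul !mulmxA.
Qed.

Lemma geodesic_velocity c i u : geodesic g c -> dom i (c u) ->
  derive1 (velocity c i) u =
    - gam g i (chart_map i (c u)) (velocity c i u) (velocity c i u).
Proof.
move=> [_ /(_ u i) h] iu; apply/eqP; rewrite -addr_eq0; apply/eqP.
exact: h.
Qed.

Lemma phase_ode c i u : geodesic g c -> dom i (c u) ->
  is_derive u 1 (phase c i) (geofield g i (phase c i u)).
Proof.
move=> gc iu; have [sc _] := gc.
have h := is_derive_row_mx (chart_is_derive sc I iu) (velocity_is_derive sc I iu).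
apply: (is_derive_eq h).
by rewrite geodesic_velocity// /geofield /phase row_mxKl row_mxKr.
Qed.

Lemma curve_near_dom c i (u : R) : smooth_curve setT c -> dom i (c u) ->
  \forall t \near u, dom i (c t).
Proof.
move=> sc iu.
have := open_nbhs_nbhs (conj (curve_dom_open (i := i) sc) (conj I iu)).
by apply: filterS => s [].
Qed.

Lemma phase_rangeP c i u : dom i (c u) -> phase_range i (phase c i u).
Proof. by move=> iu; rewrite /phase_range /phase /= row_mxKl; exists (c u). Qed.

(** Differentiating [y' = geofield y] along the solution itself shows that [y']
solves the linearized equation, and [y'] is the lift of the velocity. *)
Lemma velocity_linearized c : geodesic g c -> linearized c (velocity c).
Proof.
move=> gc; have [sc _] := gc; split; first exact: velocity_vfield.
move=> u i iu.
have E t : dom i (c t) -> lift (velocity c) i t = geofield g i (phase c i t).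
  by move=> it; rewrite /lift geodesic_velocity// /geofield /phase row_mxKl row_mxKr.
have dF := geofield_differentiable g (phase_rangeP iu).
rewrite (E u iu); have h := chain_curve (phase_ode gc iu) dF.
apply: near_eq_is_derive h.
by apply: filterS (curve_near_dom sc iu) => t /E.
Qed.

Lemma lift_comb c X Y (a : R) i t : smooth_vfield_along c X ->
  smooth_vfield_along c Y -> dom i (c t) ->
  lift (fun i u => a *: X i u + Y i u) i t = a *: lift X i t + lift Y i t.
Proof.
move=> [_ sX] [_ sY] it.
have h1 := smooth_is_derive (sX i) it; have h2 := smooth_is_derive (sY i) it.
rewrite /lift scale_row_mx add_row_mx; congr (row_mx _ _).
rewrite derive1E.
have h3 : is_derive t 1 (fun u => a *: X i u + Y i u) _ :=
  is_deriveD (is_deriveZ a h1) h2.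
by have [_ ->] := h3.
Qed.

Lemma smooth_onDZ (O : set R) (f h : R -> 'rV[R]_n) (a : R) : open O ->
  smooth_on O f -> smooth_on O h -> smooth_on O (fun t => a *: f t + h t).
Proof.
move=> oO + + k; elim: k f h => [|k IH] f h sf sh.
  move=> t Ot; have cf := smooth_on_continuous sf Ot.
  have ch := smooth_on_continuous sh Ot.
  have ca : (fun t => a *: f t) @ t --> a *: f t by exact: cvgZl_tmp.
  exact: (cvgD ca ch).
move=> v.
have D t : O t -> is_derive t v (fun t => a *: f t + h t) (a *: 'D_v f t + 'D_v h t).
  move=> Ot; apply: is_deriveD; first apply: is_deriveZ; apply: derivableP.
    exact: smooth_on_derivable sf Ot.
  exact: smooth_on_derivable sh Ot.
split; first by move=> t /D[].
apply: (Ck_on_eq oO) (IH _ _ (smooth_on_derive v sf) (smooth_on_derive v sh)).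
by move=> t /D[_ ->].
Qed.

Lemma smooth_vfield_comb c X Y (a : R) : smooth_curve setT c ->
  smooth_vfield_along c X -> smooth_vfield_along c Y ->
  smooth_vfield_along c (fun i u => a *: X i u + Y i u).
Proof.
move=> sc [lX sX] [lY sY]; split.
  by move=> t i j it jt; rewrite (lX _ i) // (lY _ i)// mulmxDl scalemxAl.
move=> i; apply: smooth_onDZ => //.
by have := curve_dom_open (i := i) sc; rewrite setTI.
Qed.

Lemma linearized_comb c X Y (a : R) : smooth_curve setT c ->
  linearized c X -> linearized c Y ->
  linearized c (fun i u => a *: X i u + Y i u).
Proof.
move=> sc [vX hX] [vY hY]; split; first exact: smooth_vfield_comb.
move=> u i iu; rewrite (lift_comb _ vX vY)//.
have dF := geofield_differentiable g (phase_rangeP iu).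
rewrite deriveD_dir// deriveZ_dir//.
have h : is_derive u 1 (fun t => a *: lift X i t + lift Y i t) _ :=
  is_deriveD (is_deriveZ a (hX u i iu)) (hY u i iu).
apply: near_eq_is_derive h.
by apply: filterS (curve_near_dom sc iu) => t it; rewrite (lift_comb _ vX vY).
Qed.

End CurvesInCharts.

(** * Jacobi fields solve the linearized geodesic equation *)

Section Jacobi.
Context {R : realType} {n : nat} {M : manifold R n} (g : riemannian_metric M).
Implicit Types (i j : chart M) (c : R -> M) (X Y Z : vfield M).
Local Notation V := 'rV[R]_n.
Implicit Types (x u v w : V).

Lemma gamC i x u v : chart_range i x -> gam g i x u v = gam g i x v u.
Proof.
move=> [p ip <-]; apply/rowP => d; rewrite !mxE exchange_big/=.
apply: eq_bigr => a _; apply: eq_bigr => b _.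
by rewrite (christoffel_torsion_free g)// mulrAC.
Qed.

Lemma gamDr i x u v w : gam g i x u (v + w) = gam g i x u v + gam g i x u w.
Proof.
apply/rowP => d; rewrite !mxE -big_split/=; apply: eq_bigr => a _.
rewrite -big_split/=; apply: eq_bigr => b _.
by rewrite mxE mulrDr.
Qed.

Lemma gamNl i x u v : gam g i x (- u) v = - gam g i x u v.
Proof.
apply/rowP => d; rewrite !mxE -sumrN; apply: eq_bigr => a _.
rewrite -sumrN; apply: eq_bigr => b _.
by rewrite mxE mulrN mulNr.
Qed.

Lemma dgamC i x w u v : chart_range i x -> dgam g i x w u v = dgam g i x w v u.
Proof.
move=> ix.
have S d a b : 'D_w (christoffel g i d a b) x = 'D_w (christoffel g i d b a) x.
  apply: near_eq_derive; have := open_nbhs_nbhs (conj (@range_open _ _ M i) ix).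
  by apply: filterS => y [p ip <-]; exact: christoffel_torsion_free.
apply/rowP => d; rewrite !mxE exchange_big/=.
by apply: eq_bigr => a _; apply: eq_bigr => b _; rewrite mulrAC S.
Qed.

Lemma dgamE i x w u v d : chart_range i x -> dgam g i x w u v 0 d =
  \sum_a \sum_b \sum_e partial e (christoffel g i d a b) x * w 0 e * u 0 a * v 0 b.
Proof.
move=> ix; rewrite mxE; apply: eq_bigr => a _; apply: eq_bigr => b _.
rewrite (C1_deriveE w (@range_open _ _ M i) (@christoffel_smooth _ _ _ g 1 i d a b) ix).
rewrite !mulr_suml; apply: eq_bigr => e _.
by rewrite [w 0 e * _]mulrC.
Qed.

(** The derivative terms and the quadratic terms of the curvature become
derivatives and compositions of [gam]. *)
Lemma curvature_opE i x u v : chart_range i x ->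
  curvature_op g i x u v v =
    dgam g i x u v v - dgam g i x v u v
    + gam g i x u (gam g i x v v) - gam g i x v (gam g i x u v).
Proof.
move=> ix; apply/rowP => d.
have E1 : dgam g i x u v v 0 d = \sum_a \sum_b \sum_c
    partial a (christoffel g i d b c) x * u 0 a * v 0 b * v 0 c.
  rewrite (dgamE _ _ _ _ ix) [RHS]exchange_big/=; apply: eq_bigr => b _.
  by rewrite [RHS]exchange_big.
have E2 : dgam g i x v u v 0 d = \sum_a \sum_b \sum_c
    partial b (christoffel g i d a c) x * u 0 a * v 0 b * v 0 c.
  rewrite (dgamE _ _ _ _ ix).
  apply: eq_bigr => a _.
  rewrite exchange_big/=.
  apply: eq_bigr => b _.
  apply: eq_bigr => c _.
  by rewrite (mulrAC _ (v 0 b) (u 0 a)).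
have E3 : gam g i x u (gam g i x v v) 0 d = \sum_a \sum_b \sum_c
    (\sum_e christoffel g i e b c x * christoffel g i d a e x)
      * u 0 a * v 0 b * v 0 c.
  rewrite mxE; apply: eq_bigr => a _.
  transitivity (\sum_e \sum_b \sum_c christoffel g i e b c x *
     christoffel g i d a e x * u 0 a * v 0 b * v 0 c).
    apply: eq_bigr => e _; rewrite mxE mulr_sumr; apply: eq_bigr => b _.
    by rewrite mulr_sumr; apply: eq_bigr => c _; ring.
  rewrite exchange_big/=; apply: eq_bigr => b _; rewrite exchange_big/=.
  by apply: eq_bigr => c _; rewrite !mulr_suml.
have E4 : gam g i x v (gam g i x u v) 0 d = \sum_a \sum_b \sum_c
    (\sum_e christoffel g i e a c x * christoffel g i d b e x)
      * u 0 a * v 0 b * v 0 c.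
  rewrite mxE [RHS]exchange_big/=; apply: eq_bigr => b _.
  transitivity (\sum_e \sum_a \sum_c christoffel g i e a c x *
     christoffel g i d b e x * u 0 a * v 0 b * v 0 c).
    apply: eq_bigr => e _; rewrite mxE mulr_sumr; apply: eq_bigr => a _.
    by rewrite mulr_sumr; apply: eq_bigr => c _; ring.
  rewrite exchange_big/=; apply: eq_bigr => a _; rewrite exchange_big/=.
  by apply: eq_bigr => c _; rewrite !mulr_suml.
have -> (p q r s : V) : (p - q + r - s) 0 d = p 0 d - q 0 d + r 0 d - s 0 d.
  by rewrite !mxE.
rewrite E1 E2 E3 E4 mxE -!sumrN -!big_split/=; apply: eq_bigr => a _.
rewrite -!sumrN -!big_split/=; apply: eq_bigr => b _.
rewrite -!sumrN -!big_split/=; apply: eq_bigr => c _.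
rewrite /curvature big_split/= sumrN.
by rewrite -!mulNr -!mulrDl addrA.
Qed.

Lemma derive_geofield_row i x v w z : chart_range i x ->
  'D_(row_mx w z) (geofield g i) (row_mx x v) =
  row_mx z (- (dgam g i x w v v + gam g i x z v + gam g i x v z)).
Proof.
move=> ix; rewrite derive_geofield; last by rewrite /phase_range/= row_mxKl.
by rewrite !row_mxKl !row_mxKr.
Qed.

(** Here [p] stands for [J''], [a] for [dgam x J T T], [b] for [gam x T J'], [d]
for [dgam x T J T], [e] for [gam x J (gam x T T)] and [f] for
[gam x T (gam x T J)]: the last three cancel between the two covariant
derivatives and the curvature. *)
Lemma jacobi_cancel (p a b d e f : V) :
  p + (d - e + b) + (b + f) + (a - d + e - f) = 0 -> p = - (a + b + b).
Proof.
move=> H; apply/eqP; rewrite -addr_eq0 -[X in _ == X]H; apply/eqP/rowP => k.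
by rewrite !mxE; ring.
Qed.

(** Expanding the two covariant derivatives and replacing [T'] by means of the
geodesic equation leaves [J''] and terms in [gam] and [dgam]; by the symmetry of
the Christoffel symbols, those which come from the curvature cancel all but the
terms of the linearized geodesic equation. *)
Lemma jacobi_linearized c J : geodesic g c -> jacobi_field g c J ->
  linearized g c J.
Proof.
move=> gc [vJ hJ]; have [sc _] := gc.
split; [exact: vJ|move=> u i iu].
have ir : chart_range i (chart_map i (c u)) by exact: range_map.
set x := chart_map i (c u).
have [_ sJ] := vJ.
have hx := chart_is_derive sc I iu.
have hT := velocity_is_derive sc I iu.
have hJ1 := smooth_is_derive (sJ i) iu.
have hJ2 := smooth_is_derive (smooth_derive1 (sJ i)) iu.
have hG := @is_derive_gam _ _ M g i _ _ _ _ _ _ _ ir hx hT hJ1.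
have [_] := is_deriveD hJ2 hG; rewrite -derive1E => hcov.
have := hJ u i iu; rewrite (curvature_opE _ _ ir) -/x.
rewrite {1}/covD.
have -> : derive1 (covD g c J i) u = derive1 (derive1 (J i)) u
  + (dgam g i x (velocity c i u) (velocity c i u) (J i u) +
     gam g i x (derive1 (velocity c i) u) (J i u) +
     gam g i x (velocity c i u) (derive1 (J i) u)) by exact: hcov.
rewrite (geodesic_velocity gc iu) -/x.
have -> : covD g c J i u = derive1 (J i) u + gam g i x (velocity c i u) (J i u) by [].
have -> : forall Y : V, \row_d \sum_a \sum_b christoffel g i d a b x *
    velocity c i u 0 a * Y 0 b = gam g i x (velocity c i u) Y by [].
rewrite gamDr gamNl.
set T := velocity c i u; set K := J i u; set K' := derive1 (J i) u.
move=> E.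
have J2 : derive1 (derive1 (J i)) u =
    - (dgam g i x K T T + gam g i x K' T + gam g i x T K').
  rewrite (gamC (gam g i x T T) K ir) (dgamC T T K ir) (gamC K T ir) in E.
  rewrite (gamC K' T ir); exact: (jacobi_cancel E).
have hJ2' := is_derive_eq hJ2 J2.
apply: (is_derive_eq (is_derive_row_mx hJ1 hJ2')).
by rewrite [RHS](derive_geofield_row _ _ _ ir).
Qed.

End Jacobi.

(** * Change of charts on the tangent bundle *)

Section ChartChange.
Context {R : realType} {n : nat} {M : manifold R n}.
Implicit Types (i j : chart M) (c : R -> M) (Z : vfield M).
Local Notation V := 'rV[R]_n.

(** The differential of the change of charts, applied to [v]. *)
Definition push i j (x v : V) : V :=
  \row_b \sum_a v 0 a * partial a (fun y => transition i j y 0 b) x.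

(** The second derivative of the change of charts, applied to [w] and [v]. *)
Definition dpush i j (x w v : V) : V :=
  \row_b \sum_a v 0 a * 'D_w (partial a (fun y => transition i j y 0 b)) x.

(** The change of charts induced on the tangent bundle. *)
Definition tmap i j (y : 'rV[R]_(n + n)) : 'rV[R]_(n + n) :=
  row_mx (transition i j (lsubmx y)) (push i j (lsubmx y) (rsubmx y)).

Lemma push_change i j p v : dom i p -> dom j p ->
  push i j (chart_map i p) v = v *m change_mx i j p.
Proof.
move=> ip jp; apply/rowP => b; rewrite !mxE; apply: eq_bigr => a _.
by rewrite change_mxE.
Qed.

Lemma push_derive i j x v : overlap i j x ->
  'D_v (transition i j) x = push i j x v.
Proof.
move=> ox; apply/rowP => b.
rewrite derive_entry; last exact/diff_derivable/transition_differentiable.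
rewrite mxE; apply: (C1_deriveE _ (@overlap_open _ _ _ i j)) => //.
exact: transition_entry_smooth.
Qed.

Lemma dpushC i j x w v : overlap i j x -> dpush i j x w v = dpush i j x v w.
Proof.
move=> ox; apply/rowP => b; rewrite [LHS]mxE [RHS]mxE.
have oA := @overlap_open _ _ _ i j.
have E u a : 'D_u (partial a (fun y => transition i j y 0 b)) x =
    \sum_e u 0 e * partial e (partial a (fun y => transition i j y 0 b)) x.
  apply: (C1_deriveE _ oA) => //; apply: Ck_on_partial.
  exact: transition_entry_smooth.
have S a e : partial e (partial a (fun y => transition i j y 0 b)) x =
    partial a (partial e (fun y => transition i j y 0 b)) x.
  by apply: (schwarz _ _ oA) => //; exact: transition_entry_smooth.
have E2 (u v' : V) : \sum_a v' 0 a * 'D_u (partial a (fun y => transition i j y 0 b)) x =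
    \sum_a \sum_e v' 0 a *
      (u 0 e * partial e (partial a (fun y => transition i j y 0 b)) x).
  by apply: eq_bigr => a _; rewrite (E u a) mulr_sumr.
rewrite [LHS](E2 w v) [RHS](E2 v w) [LHS]exchange_big/=.
apply: eq_bigr => a _.
by apply: eq_bigr => e _; rewrite (S e a) mulrCA.
Qed.

Lemma is_derive_push i j (x v : R -> V) (t : R) (dx dv : V) :
  overlap i j (x t) -> is_derive t 1 x dx -> is_derive t 1 v dv ->
  is_derive t 1 (fun r => push i j (x r) (v r))
    (dpush i j (x t) dx (v t) + push i j (x t) dv).
Proof.
move=> ox hx hv; apply: is_derive_mx => z b; rewrite {z}ord1.
under eq_fun do rewrite mxE.
rewrite (_ : (fun _ => _) = \sum_a (fun r =>
  v r 0 a * partial a (fun y => transition i j y 0 b) (x r))); last first.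
  by apply/funext => r; rewrite fct_sumE.
rewrite !mxE -big_split/=; apply: is_derive_sum => a.
have hP : is_derive t 1 (fun r => partial a (fun y => transition i j y 0 b) (x r))
    ('D_dx (partial a (fun y => transition i j y 0 b)) (x t)).
  apply: (@chain_curve _ _ _ x (partial a (fun y => transition i j y 0 b))) => //.
  apply: C1_differentiable (ox); first exact: overlap_open.
  by apply: Ck_on_partial; exact: transition_entry_smooth.
have hva := is_derive_mxE 0 a hv.
apply: (is_derive_eq (is_deriveM hva hP)).
have sE (p q : R) : p *: q = p * q by [].
by rewrite !sE [X in _ + X]mulrC.
Qed.

Definition phase_overlap i j : set 'rV[R]_(n + n) := lsubmx @^-1` overlap i j.

Lemma phase_overlap_open i j : open (phase_overlap i j).
Proof.
by apply: open_comp; [move=> y _; exact: lsubmx_continuous|exact: overlap_open].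
Qed.

Lemma tmap_smooth k i j (b : 'I_(n + n)) :
  Ck_on k (phase_overlap i j) (fun y => tmap i j y 0 b).
Proof.
have oA := @phase_overlap_open i j.
case: (split_ordP b) => a ->{b}.
  apply: (@Ck_on_eq _ _ _ _ _
    (fun y : 'rV[R]_(n + n) => transition i j (lsubmx y) 0 a)) => //.
    by move=> y _; rewrite row_mxEl.
  by apply: (@Ck_on_lsubmx _ _ _ _ (fun x => transition i j x 0 a));
    exact: transition_entry_smooth.
apply: (@Ck_on_eq _ _ _ _ _ (fun y : 'rV[R]_(n + n) => \sum_c
    y 0 (rshift n c) * partial c (fun y => transition i j y 0 a) (lsubmx y))) => //.
  by move=> y _; rewrite row_mxEr !mxE; apply: eq_bigr => c _; rewrite !mxE.
apply: Ck_on_sum => // c.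
apply: Ck_onM => //; first exact: Ck_on_coord.
apply: Ck_on_lsubmx; apply: Ck_on_partial; exact: transition_entry_smooth.
Qed.

Lemma tmap_differentiable i j y : phase_overlap i j y -> differentiable (tmap i j) y.
Proof.
apply: (C1_mx_differentiable (@phase_overlap_open i j)) => a b; rewrite ord1.
exact: tmap_smooth.
Qed.

Lemma is_derive_affine (m : nat) (y z : 'rV[R]_m) :
  is_derive (0 : R) 1 (fun r : R => y + r *: z) z.
Proof.
have d : derivable (id : 'rV[R]_m -> 'rV[R]_m) (y + 0 *: z) z by exact: derivable_id.
by have := is_derive_line d; rewrite derive_id.
Qed.

Lemma derive_tmap i j x v w z : overlap i j x ->
  'D_(row_mx w z) (tmap i j) (row_mx x v) =
  row_mx (push i j x w) (dpush i j x w v + push i j x z).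
Proof.
move=> ox.
have po : phase_overlap i j (row_mx x v) by rewrite /phase_overlap/= row_mxKl.
have d : derivable (tmap i j) (row_mx x v + 0 *: row_mx w z) (row_mx w z).
  by rewrite scale0r addr0; apply: diff_derivable; exact: tmap_differentiable.
have [_] := is_derive_line d; rewrite scale0r addr0 => <-.
have E : (fun r : R => tmap i j (row_mx x v + r *: row_mx w z)) =
    (fun r => row_mx (transition i j (x + r *: w)) (push i j (x + r *: w) (v + r *: z))).
  by apply/funext => r; rewrite scale_row_mx add_row_mx /tmap row_mxKl row_mxKr.
rewrite {}E.
have ox0 : overlap i j (x + 0 *: w) by rewrite scale0r addr0.
have h1 := chain_curve (is_derive_affine x w) (transition_differentiable ox0).
have h2 := is_derive_push ox0 (is_derive_affine x w) (is_derive_affine v z).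
have [_ ->] := is_derive_row_mx h1 h2.
by rewrite !scale0r !addr0 push_derive.
Qed.

Lemma phase_change c i j u : smooth_curve setT c ->
  dom i (c u) -> dom j (c u) -> phase c j u = tmap i j (phase c i u).
Proof.
move=> sc iu ju; rewrite /tmap /phase row_mxKl row_mxKr.
by rewrite transition_map// push_change// (velocity_change sc I iu ju).
Qed.

(** The derivative of the components of [Z] in the new chart differentiates the
Jacobian matrix along [c'], while the differential of [tmap] differentiates it
along [Z]; [dpushC] identifies the two. *)
Lemma lift_change c Z i j u : smooth_curve setT c -> smooth_vfield_along c Z ->
  dom i (c u) -> dom j (c u) ->
  lift Z j u = 'D_(lift Z i u) (tmap i j) (phase c i u).
Proof.
move=> sc [lZ sZ] iu ju.
have ov : overlap i j (chart_map i (c u)) by exists (c u).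
rewrite [RHS](derive_tmap _ _ _ ov) /lift; congr row_mx.
  by rewrite push_change// -lZ.
have h := is_derive_push ov (chart_is_derive sc I iu) (smooth_is_derive (sZ i) iu).
have [_ <-] := smooth_is_derive (sZ j) ju.
rewrite dpushC//; case: h => _ <-.
apply: near_eq_derive.
apply: filterS2 (curve_near_dom sc iu) (curve_near_dom sc ju) => t it jt.
by rewrite push_change// -lZ.
Qed.

End ChartChange.

(** The supremum of the points up to which [P] holds satisfies [P] by the first
closure property, and cannot lie before [b] by the second one. *)
(** * Unit speed curves in a chart ball *)

Lemma itv_induction {R : realType} (P : R -> Prop) (a b : R) : P a ->
  (forall u, a < u <= b -> (forall v, a <= v < u -> P v) -> P u) ->
  (forall u, a <= u < b -> (forall v, a <= v <= u -> P v) ->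
     exists2 e, 0 < e & forall v, u <= v < u + e -> P v) ->
  forall u, a <= u <= b -> P u.
Proof.
move=> Pa Pl Pr u /andP[au ub].
pose S := [set x | a <= x <= b /\ forall v, a <= v <= x -> P v].
have Sa : S a.
  rewrite /S /= lexx (le_trans au ub); split => // v.
  by rewrite -eq_le => /eqP <-.
have Sb x : S x -> x <= b by case=> /andP[].
have hS : has_sup S by split; [exists a|exists b => x /Sb].
pose m := sup S.
have am : a <= m by exact: ub_le_sup hS.2 _ Sa.
have mb : m <= b by apply: ge_sup; [exists a|move=> x /Sb].
have Pm v : a <= v < m -> P v.
  move=> /andP[av vm].
  have [x Sx vx] := sup_gt hS.1 vm.
  by apply: Sx.2; rewrite av ltW.
have PPm : P m.
  have [am'|ma] := ltP a m; first by apply: Pl => //; rewrite am' mb.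
  by have -> : m = a by apply/eqP; rewrite eq_le ma am.
have Pm' v : a <= v <= m -> P v.
  move=> /andP[av]; rewrite le_eqVlt => /predU1P[->//|vm].
  by apply: Pm; rewrite av vm.
have [mb'|bm] := ltP m b; last first.
  by apply: Pm'; rewrite au (le_trans ub bm).
have [|e e0 eP] := Pr m _ Pm'; first by rewrite am mb'.
pose x := Num.min b (m + e / 2).
have e20 : 0 < e / 2 by rewrite divr_gt0.
have mx : m < x by rewrite lt_min mb' ltrDl.
have Sx : S x.
  split; first by rewrite (le_trans am (ltW mx)) ge_min lexx.
  move=> v /andP[av vx]; have [vm|mv] := leP v m; first by apply: Pm'; rewrite av vm.
  apply: eP; rewrite ltW//= (le_lt_trans vx)// gt_min ltrD2l.
  by rewrite ltr_pdivrMr// ltr_pMr// ltr1n orbT.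
by have := ub_le_sup hS.2 Sx; rewrite leNgt mx.
Qed.

Lemma continuous_dist {R : realType} (W : normedModType R) (x0 : W) :
  continuous (fun x : W => `|x - x0|).
Proof.
move=> x; have c1 : (fun y : W => y - x0) @ x --> x - x0.
  by apply: cvgB; [exact: cvg_id|exact: cvg_cst].
exact: (cvg_norm c1).
Qed.

Lemma cvg_dist0 {R : realType} (W : normedModType R) {T : Type}
    (F : set_system T) {FF : Filter F} (f : T -> W) (l : W) :
  f s @[s --> F] --> l -> `|f s - l| @[s --> F] --> (0 : R).
Proof.
move=> fl; rewrite -(normr0 W) -(subrr l).
exact: (cvg_comp _ _ fl (@continuous_dist _ _ l _)).
Qed.

Section Staying.
Context {R : realType} {n : nat} {M : manifold R n} (g : riemannian_metric M).
Implicit Types (i j : chart M) (c : R -> M).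
Local Notation V := 'rV[R]_n.

Definition quad i (x v : V) : R := (v *m g i x *m v^T) 0 0.

Lemma quadE i x v : quad i x v = \sum_b (\sum_a v 0 a * g i x a b) * v 0 b.
Proof. by rewrite /quad mxE; apply: eq_bigr => b _; rewrite !mxE. Qed.

Lemma quadZ i x v (a : R) : quad i x (a *: v) = a ^+ 2 * quad i x v.
Proof.
by rewrite /quad linearZ/= -!scalemxAl -scalemxAr !mxE mulrA expr2.
Qed.

Lemma cvg_quad i {T : Type} (F : set_system T) {FF : Filter F}
    (x v : T -> V) (x0 v0 : V) : chart_range i x0 ->
  x s @[s --> F] --> x0 -> v s @[s --> F] --> v0 ->
  quad i (x s) (v s) @[s --> F] --> quad i x0 v0.
Proof.
move=> rx xc vc.
rewrite (_ : (fun s => quad i (x s) (v s)) = fun s =>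
    \sum_b (\sum_a v s 0 a * g i (x s) a b) * v s 0 b); last first.
  by apply/funext => s; rewrite quadE.
rewrite quadE; apply: cvg_sum => b _; apply: cvgM; last exact: cvg_entry.
apply: cvg_sum => a _; apply: cvgM; first exact: cvg_entry.
exact: (cvg_comp _ _ xc (@gram_entry_smooth _ _ _ g 0 i a b _ rx)).
Qed.

(** On the compact set of pairs of a point of the ball and a vector of norm one
the metric has a positive minimum; scaling the vector gives the rest. *)
Lemma quad_lower_bound i x0 (r : R) :
  (forall x, `|x - x0| <= r -> chart_range i x) ->
  exists2 k, 0 < k & forall x v, `|x - x0| <= r -> k * `|v| ^+ 2 <= quad i x v.
Proof.
move=> rr.
(* For [n = 0] this set is empty and the bound is void. *)
pose S := [set y : 'rV[R]_(n + n) | `|lsubmx y - x0| <= r /\ `|rsubmx y| = 1].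
have q0 x v : `|x - x0| <= r -> v != 0 -> 0 < quad i x v.
  by move=> /rr[p ip <-] v0; exact: gram_posdef.
have quad0 x : quad i x 0 = 0 by rewrite /quad !mul0mx mxE.
have [S0|/set0P/negP/negPn/eqP S0] := pselect (S !=set0); last first.
  exists 1 => // x v xr; have [->|v0] := eqVneq v 0.
    by rewrite quad0 normr0 expr0n mulr0.
  have : S (row_mx x (`|v|^-1 *: v)).
    rewrite /S /= row_mxKl row_mxKr; split => //.
    by rewrite normrZ normfV normr_id mulVf// normr_eq0.
  by rewrite S0.
have cS : compact S.
  apply: bounded_closed_compact.
    exists (r + `|x0| + 1); split; first exact: num_real.
    move=> m rm y [y1 y2].
    have y3 : `|lsubmx y| <= r + `|x0|.
      by rewrite -[lsubmx y](subrK x0) (le_trans (ler_normD _ _))// lerD2r.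
    have r0 : 0 <= r by apply: le_trans y1.
    rewrite -[y]hsubmxK; apply: norm_row_mx_le; apply: le_trans (ltW rm).
      by rewrite (le_trans y3)// lerDl.
    by rewrite y2 lerDr addr_ge0.
  apply: closedI.
    apply: (@closed_comp _ _ (fun y : 'rV[R]_(n + n) => `|lsubmx y - x0|) [set z | z <= r]);
      last exact: closed_le.
    move=> y _.
    exact: (continuous_comp (@lsubmx_continuous _ _ y) (@continuous_dist _ _ x0 _)).
  apply: (@closed_comp _ _ (fun y : 'rV[R]_(n + n) => `|rsubmx y|) [set z | z = 1]);
    last exact: closed_eq.
  by move=> y _; exact: (cvg_norm (@rsubmx_continuous _ _ y)).
have [y|y yS ymin] := @EVT_min_rV R _ (fun y => quad i (lsubmx y) (rsubmx y)) S S0 cS.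
  apply: continuous_in_subspaceT => {}y /set_mem[y1 y2].
  exact: (cvg_quad (rr _ y1) (@lsubmx_continuous _ _ y) (@rsubmx_continuous _ _ y)).
move/set_mem : yS => [y1 y2].
exists (quad i (lsubmx y) (rsubmx y)).
  apply: q0 => //; apply/eqP => y0; move: y2; rewrite y0 normr0 => /esym/eqP.
  by rewrite oner_eq0.
move=> x v xr; have [->|v0] := eqVneq v 0.
  by rewrite quad0 normr0 expr0n mulr0.
have vv : 0 < `|v| by rewrite normr_gt0.
have : S (row_mx x (`|v|^-1 *: v)).
  rewrite /S /= row_mxKl row_mxKr; split => //.
  by rewrite normrZ normfV normr_id mulVf// gt_eqF.
move=> /mem_set/ymin; rewrite row_mxKl row_mxKr quadZ => H.
by rewrite -ler_pdivlMr ?exprn_gt0// mulrC -exprVn.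
Qed.

Lemma speed_quad c i (u : R) : smooth_curve setT c -> dom i (c u) ->
  quad i (chart_map i (c u)) (velocity c i u) = speed g c u ^+ 2.
Proof.
move=> sc iu.
have E : inner g c (velocity c) (velocity c) u =
    quad i (chart_map i (c u)) (velocity c i u).
  by rewrite (@innerE _ _ _ _ _ _ _ _ i)// => j ju; exact: (velocity_change sc).
apply/esym; rewrite -[RHS]E; apply: sqr_sqrtr; rewrite [leRHS]E.
have [->|v0] := eqVneq (velocity c i u) 0; first by rewrite /quad !mul0mx mxE.
by apply: ltW; exact: gram_posdef.
Qed.

Lemma rV_mean_value (f : R -> V) (df : R -> V) (a b C : R) : a <= b -> 0 <= C ->
  (forall u, u \in `[a, b]%R -> is_derive u 1 f (df u)) ->
  (forall u, u \in `[a, b]%R -> `|df u| <= C) ->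
  `|f b - f a| <= C * (b - a).
Proof.
move=> ab C0 fP dC; apply: norm_le_coord => [|i j].
  by rewrite mulr_ge0// subr_ge0.
rewrite ord1 !mxE.
have fj u : u \in `[a, b]%R -> is_derive u 1 (fun t => f t 0 j) (df u 0 j).
  by move=> /fP; exact: is_derive_mxE.
have [|c cab ->] := @MVT_segment R (fun t => f t 0 j) (fun t => df t 0 j) a b ab
  (fun u h => fj u (subset_itv_oo_cc h)).
  by apply: derivable_within_continuous => u /fj[].
rewrite normrM [X in _ * X]ger0_norm ?subr_ge0// ler_wpM2r ?subr_ge0//.
by rewrite (le_trans (norm_coord_le _ _ _))// dC.
Qed.

(** By [quad_lower_bound] a unit speed curve has coordinate velocity at most [C]
in the ball, so it needs a time of order [r / C] to get from the ball of radius
[r / 2] to the sphere of radius [r].  It cannot leave the domain of the chart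
meanwhile, because the closed ball is compact and hence closed in [M]. *)
Lemma unit_speed_stays i x0 : chart_range i x0 ->
  exists r C d, [/\ 0 < r, 0 <= C, 0 < d <= 1,
    forall x, `|x - x0| <= r -> chart_range i x &
    forall c (u0 : R), smooth_curve setT c -> (forall u, speed g c u = 1) ->
      dom i (c u0) -> `|chart_map i (c u0) - x0| <= r / 2 ->
      forall u, u0 <= u <= u0 + d ->
        [/\ dom i (c u), `|chart_map i (c u) - x0| <= r &
            `|velocity c i u| <= C] ].
Proof.
move=> rx0.
have /nbhs_ballP[r1 /= r10 rP] := open_nbhs_nbhs (conj (@range_open _ _ M i) rx0).
pose r := r1 / 2.
have r0 : 0 < r by rewrite divr_gt0.
have rr x : `|x - x0| <= r -> chart_range i x.
  move=> xr; apply: rP; rewrite -ball_normE /ball_/= distrC (le_lt_trans xr)//.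
  by rewrite /r ltr_pdivrMr// ltr_pMr// ltr1n.
have [k k0 kP] := quad_lower_bound rr.
pose C := Num.sqrt k^-1.
have C0 : 0 <= C by exact: sqrtr_ge0.
(* In time [d] the curve moves by at most [C * d <= r / 4], from the ball of
   radius [r / 2] to the one of radius [3 r / 4]. *)
pose d := Num.min 1 (r / (4 * (C + 1))).
have C10 : 0 < 4 * (C + 1) by rewrite mulr_gt0// ltr_wpDl.
have d0 : 0 < d by rewrite lt_min ltr01 divr_gt0.
have Cd : C * d <= r / 4.
  apply: (@le_trans _ _ ((C + 1) * (r / (4 * (C + 1))))).
    by apply: ler_pM => //; [exact: ltW|rewrite lerDl|rewrite ge_min lexx orbT].
  have C1 : C + 1 != 0 by rewrite gt_eqF// ltr_wpDl.
  rewrite [leLHS](_ : _ = r / 4)//.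
  by rewrite invfM mulrCA -mulrA mulrA [4^-1 * _]mulrC !mulrA mulfK// mulrC.
exists r, C, d; split => //; first by rewrite d0 ge_min lexx.
move=> c u0 sc sp iu0 xu0.
have vC u : dom i (c u) -> `|chart_map i (c u) - x0| <= r -> `|velocity c i u| <= C.
  move=> iu xu; have := kP _ (velocity c i u) xu.
  rewrite speed_quad// sp expr1n mulrC -ler_pdivlMr// mul1r => h.
  by rewrite -[leLHS]ger0_norm// -sqrtr_sqr ler_wsqrtr.
have [_ cc _] := sc.
pose K := chart_inv i @` [set x : V | `|x - x0| <= r].
have cK : closed K.
  apply: compact_closed; first exact: mpoint_hausdorff.
  apply: continuous_compact.
    apply: continuous_in_subspaceT => x /set_mem /rr xi.
    exact: chart_inv_continuous.
  apply: bounded_closed_compact.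
    exists (r + `|x0|); split; first exact: num_real.
    move=> m rm x /= xr; apply: le_trans (ltW rm).
    by rewrite -[x](subrK x0) (le_trans (ler_normD _ _))// lerD2r.
  apply: (@closed_comp _ _ (fun x : V => `|x - x0|) [set z | z <= r]);
    last exact: closed_le.
  by move=> y _; exact: continuous_dist.
have KP u : K (c u) <-> dom i (c u) /\ `|chart_map i (c u) - x0| <= r.
  split=> [[x xr <-]|[iu xu]].
    by have [h1 h2] := range_inv (rr _ xr); rewrite h2.
  by exists (chart_map i (c u)) => //; exact: chart_mapK.
have r2r : r / 2 <= r by rewrite ler_pdivrMr// ler_pMr// ler1n.
suff H u : u0 <= u <= u0 + d -> K (c u).
  by move=> u /H/KP[h1 h2]; split => //; exact: vC.
apply: (@itv_induction R (fun u => K (c u)) u0 (u0 + d)).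
- by apply/KP; split; [exact: iu0|exact: le_trans xu0 r2r].
- move=> v /andP[u0v _] Kv.
  have h : (c @^-1` K) v; last exact: h.
  have cl : closed (c @^-1` K).
    by apply: (@closed_comp _ _ c K) => // z _; exact: cc.
  apply: cl => B /nbhs_ballP[e /= e0 eB].
  pose w := Num.max u0 (v - e / 2).
  have e20 : 0 < e / 2 by rewrite divr_gt0.
  have wv : w < v by rewrite gt_max u0v ltrBlDr ltrDl.
  exists w; split; first by apply: Kv; rewrite wv andbT le_max lexx.
  apply: eB; rewrite -ball_normE /ball_/= gtr0_norm ?subr_gt0//.
  rewrite ltrBlDr -ltrBlDl lt_max; apply/orP; right.
  by rewrite ltrD2l ltrN2 ltr_pdivrMr// ltr_pMr// ltr1n.
- move=> v /andP[u0v vd] Kv.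
  have Dv w : w \in `[u0, v]%R -> dom i (c w) /\ `|velocity c i w| <= C.
    by rewrite in_itv/= => /Kv/KP[h1 h2]; split => //; exact: vC.
  have mv := @rV_mean_value (chart_map i \o c) (velocity c i) u0 v C u0v C0
    (fun w h => chart_is_derive sc I (Dv w h).1) (fun w h => (Dv w h).2).
  have vv : v \in `[u0, v]%R by rewrite in_itv/= u0v lexx.
  have iv := (Dv v vv).1.
  have xv : `|chart_map i (c v) - x0| < r.
    rewrite -(subrKA (chart_map i (c u0))).
    apply: (le_lt_trans (ler_normD _ _)).
    apply: (@le_lt_trans _ _ (r / 4 + r / 2)); last by lra.
    apply: lerD => //; apply: (le_trans mv); apply: le_trans Cd.
    by rewrite ler_wpM2l// lerBlDl ltW.
  have n1 := curve_near_dom sc iv.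
  have n2 : \forall w \near v, `|chart_map i (c w) - x0| < r.
    have cx : `|(chart_map i \o c) w - x0| @[w --> v] --> `|(chart_map i \o c) v - x0|.
      have [/derivable1_diffP/differentiable_continuous h _] :=
        chart_is_derive sc I iv.
      exact: (continuous_comp h (@continuous_dist _ _ x0 _)).
    exact: (cvgr_lt _ cx).
  have /nbhs_ballP[e /= e0 eP] : \forall w \near v,
      dom i (c w) /\ `|chart_map i (c w) - x0| < r.
    by apply: filterS2 n1 n2.
  exists e => // w /andP[vw we]; apply/KP.
  have /eP[h1 h2] : ball v e w.
    by rewrite -ball_normE /ball_/= distrC ger0_norm ?subr_ge0// ltrBlDl.
  by split => //; exact: ltW.
Qed.

End Staying.

(** * Differentiability of a family of geodesics in its parameter *)

Section Propagation.
Context {R : realType} {n : nat} {M : manifold R n} (g : riemannian_metric M).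
Variables (D : set R) (s0 : R) (lam : R -> R -> M) (Z : R -> vfield M).
Hypothesis Ds0 : D s0.
Hypothesis lam_geodesic : forall s, D s -> geodesic g (lam s).
Hypothesis lam_speed : forall s, D s -> forall u, speed g (lam s) u = 1.
Hypothesis Z_lin : forall s, D s -> linearized g (lam s) (Z s).
Implicit Types (i j : chart M).

(** The property that is propagated along the poles.  Its last clause, the
continuity of the derivative in the parameter, serves to integrate the speed of
the tractor. *)
Definition varies_in i (u : R) : Prop :=
  [/\ \forall s \near within D (nbhs s0), dom i (lam s u),
      expands D s0 (fun s => phase (lam s) i u) (lift (Z s0) i u) &
      lift (Z s) i u @[s --> within D (nbhs s0)] --> lift (Z s0) i u].

Lemma lam_smooth s : D s -> smooth_curve setT (lam s).
Proof. by move=> /lam_geodesic[]. Qed.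

Lemma near_D : \forall s \near within D (nbhs s0), D s.
Proof. by rewrite near_withinE; apply: nearW => s. Qed.

(** Phase points and lifts in the second chart are the images under [tmap] and
its differential of those in the first one. *)
Lemma varies_change i j u : dom i (lam s0 u) -> dom j (lam s0 u) ->
  varies_in i u -> varies_in j u.
Proof.
move=> iu ju [ni ei li].
have cphase := expands_cvg ei.
have po : phase_overlap i j (phase (lam s0) i u).
  by rewrite /phase_overlap /phase /= row_mxKl; exists (lam s0 u).
have ov : overlap i j (chart_map i (lam s0 u)) by exists (lam s0 u).
have cmap : chart_map i (lam s u) @[s --> within D (nbhs s0)] -->
    chart_map i (lam s0 u).
  have := cvg_comp _ _ cphase (@lsubmx_continuous _ _ _).
  rewrite {2}/phase row_mxKl; apply: cvg_trans; apply: near_eq_cvg.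
  by apply: nearW => s; rewrite /= /phase row_mxKl.
have nj : \forall s \near within D (nbhs s0), dom j (lam s u).
  have nov : \forall s \near within D (nbhs s0), overlap i j (chart_map i (lam s u)).
    by apply: (cmap (overlap i j)); apply: open_nbhs_nbhs; split => //; exact: overlap_open.
  by apply: filterS2 ni nov => s si /overlapP[_]; rewrite chart_mapK.
have neq : \forall s \near within D (nbhs s0),
    tmap i j (phase (lam s) i u) = phase (lam s) j u.
  apply: filterS3 near_D ni nj => s Ds si sj.
  by rewrite (phase_change (lam_smooth Ds) si sj).
have [vZ0 _] := Z_lin Ds0.
have E0 := lift_change (lam_smooth Ds0) vZ0 iu ju.
split; first exact: nj.
  have := @expands_comp _ D s0 _ _ (tmap i j) (fun s => phase (lam s) i u) _
    (tmap_differentiable po) ei.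
  rewrite -E0; apply: expands_near_eq; last exact: neq.
  by rewrite /= (phase_change (lam_smooth Ds0) iu ju).
rewrite E0.
have c := @cvg_derive _ _ _ _ (within D (nbhs s0)) _ _ (tmap i j)
  (fun s => phase (lam s) i u) (fun s => lift (Z s) i u) _ _
  (@phase_overlap_open _ _ _ i j) (fun b => @tmap_smooth _ _ _ 1 i j b)
  po cphase li.
apply: (cvg_trans _ (c _)); apply: near_eq_cvg.
apply: filterS3 near_D ni nj => s Ds si sj.
have [vZ _] := Z_lin Ds.
exact: (esym (lift_change (lam_smooth Ds) vZ si sj)).
Qed.

(** Around the time [us] the phase points of all poles with parameter close to
[s0] stay, for a common time, in a compact convex part of the phase space of one
chart, where [ode_comparison] applies. *)
Lemma varies_local (us : R) i : dom i (lam s0 us) ->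
  exists2 d, 0 < d & forall u0 u1 : R, `|u0 - us| < d -> `|u1 - us| < d ->
    u0 <= u1 -> [/\ dom i (lam s0 u0), dom i (lam s0 u1) &
      varies_in i u0 -> varies_in i u1].
Proof.
move=> ius; pose x0 := chart_map i (lam s0 us).
have rx0 : chart_range i x0 by exact: range_map.
have [r [C [d [r0 C0 /andP[d0 d1] rr stay]]]] := unit_speed_stays g rx0.
pose K := [set y : 'rV[R]_(n + n) | `|lsubmx y - x0| <= r /\ `|rsubmx y| <= C].
have KA : K `<=` phase_range i by move=> y [/rr].
have cK : compact K.
  apply: bounded_closed_compact.
    exists (r + `|x0| + C); split; first exact: num_real.
    move=> m rm y [y1 y2].
    have y3 : `|lsubmx y| <= r + `|x0|.
      by rewrite -[lsubmx y](subrK x0) (le_trans (ler_normD _ _))// lerD2r.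
    rewrite -[y]hsubmxK; apply: norm_row_mx_le; apply: le_trans (ltW rm).
      by rewrite (le_trans y3)// lerDl.
    by rewrite (le_trans y2)// lerDr addr_ge0// ltW.
  apply: closedI.
    apply: (@closed_comp _ _ (fun y : 'rV[R]_(n + n) => `|lsubmx y - x0|) [set z | z <= r]);
      last exact: closed_le.
    move=> y _.
    exact: (continuous_comp (@lsubmx_continuous _ _ y) (@continuous_dist _ _ x0 _)).
  apply: (@closed_comp _ _ (fun y : 'rV[R]_(n + n) => `|rsubmx y|) [set z | z <= C]);
    last exact: closed_le.
  by move=> y _; exact: (cvg_norm (@rsubmx_continuous _ _ y)).
have vK : convex_set K.
  have cvx (V : normedModType R) (a b x : V) (t e : R) : `|a - x| <= e ->
      `|b - x| <= e -> t \in `[0, 1]%R -> `|a + t *: (b - a) - x| <= e.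
    move=> ae be; rewrite in_itv/= => /andP[t0 t1].
    have -> : a + t *: (b - a) - x = (1 - t) *: (a - x) + t *: (b - x).
      rewrite scalerBl scale1r -[RHS]addrA [X in _ = _ + X]addrC -scalerBr.
      by rewrite opprB subrKA addrAC.
    apply: (le_trans (ler_normD _ _)); rewrite !normrZ !ger0_norm ?subr_ge0//.
    have h1 : (1 - t) * `|a - x| <= (1 - t) * e by rewrite ler_wpM2l// subr_ge0.
    have h2 : t * `|b - x| <= t * e by rewrite ler_wpM2l.
    by apply: (le_trans (lerD h1 h2)); rewrite -mulrDl subrK mul1r.
  move=> a b t [a1 a2] [b1 b2] t01; split; rewrite linearD linearZ linearB/=.
    exact: cvx.
  have := @cvx _ (rsubmx a) (rsubmx b) 0 t C; rewrite !subr0; exact.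
have [C' C'0 CP] := ode_comparison (@phase_range_open _ _ _ i)
  (fun b => @geofield_smooth _ _ _ g 2 i b) cK KA vK.
have sc0 := lam_smooth Ds0.
have cl0 : chart_map i (lam s0 u) @[u --> us] --> x0.
  have [/derivable1_diffP/differentiable_continuous h _] :=
    chart_is_derive sc0 I ius.
  exact: h.
have n2 : \forall u \near us, `|chart_map i (lam s0 u) - x0| < r / 4.
  have cx : `|chart_map i (lam s0 u) - x0| @[u --> us] --> `|x0 - x0|.
    exact: (cvg_comp _ _ cl0 (@continuous_dist _ _ x0 _)).
  apply: (cvgr_lt _ cx); rewrite subrr normr0 divr_gt0//.
have /nbhs_ballP[e /= e0 eP] : \forall u \near us,
    dom i (lam s0 u) /\ `|chart_map i (lam s0 u) - x0| < r / 4.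
  by apply: filterS2 (curve_near_dom sc0 ius) n2.
(* Two times within [d / 2] of [us] differ by less than the staying time [d]. *)
exists (Num.min e (d / 2)); first by rewrite lt_min e0 divr_gt0.
move=> u0 u1; rewrite !lt_min => /andP[u0e u0d] /andP[u1e u1d] u01.
have iu0 : dom i (lam s0 u0) /\ `|chart_map i (lam s0 u0) - x0| < r / 4.
  by apply: eP; rewrite -ball_normE /ball_/= distrC.
have iu1 : dom i (lam s0 u1) /\ `|chart_map i (lam s0 u1) - x0| < r / 4.
  by apply: eP; rewrite -ball_normE /ball_/= distrC.
split; [exact: iu0.1|exact: iu1.1|move=> [ni ei li]].
have u1d' : u1 <= u0 + d.
  rewrite -lerBlDl; apply: (le_trans (ler_norm _)).
  rewrite -(subrKA us) (le_trans (ler_normD _ _))// [d]splitr lerD ?ltW//.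
  by rewrite distrC.
have u1p : u1 <= u0 + 1 by rewrite (le_trans u1d')// lerD2l.
have cphase := expands_cvg ei.
have cmap : chart_map i (lam s u0) @[s --> within D (nbhs s0)] -->
    chart_map i (lam s0 u0).
  have := cvg_comp _ _ cphase (@lsubmx_continuous _ _ _).
  rewrite {2}/phase row_mxKl; apply: cvg_trans; apply: near_eq_cvg.
  by apply: nearW => s; rewrite /= /phase row_mxKl.
have nr : \forall s \near within D (nbhs s0),
    `|chart_map i (lam s u0) - x0| < r / 2.
  have cx := cvg_comp _ _ cmap (@continuous_dist _ _ x0 _).
  apply: (cvgr_lt _ cx); apply: (lt_trans iu0.2).
  by rewrite ltr_pM2l// ltf_pV2 ?posrE// ltr_nat.
have inK s : D s -> dom i (lam s u0) -> `|chart_map i (lam s u0) - x0| <= r / 2 ->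
   forall u, u \in `[u0, u1]%R -> dom i (lam s u) /\ K (phase (lam s) i u).
  move=> Ds si sr u; rewrite in_itv/= => /andP[u0u uu1].
  have [|h1 h2 h3] := stay _ _ (lam_smooth Ds) (lam_speed Ds) si sr u.
    by rewrite u0u (le_trans uu1 u1d').
  by split => //; rewrite /K /= /phase row_mxKl row_mxKr.
have in0 : `|chart_map i (lam s0 u0) - x0| <= r / 2.
  apply: ltW; apply: (lt_trans iu0.2).
  by rewrite ltr_pM2l// ltf_pV2 ?posrE// ltr_nat.
have K0 := inK s0 Ds0 iu0.1 in0.
pose y s u := phase (lam s) i u.
pose z s u := lift (Z s) i u.
have main : \forall s \near within D (nbhs s0), dom i (lam s u1) /\
  [/\ `|y s u1 - y s0 u1| <= C' * `|y s u0 - y s0 u0|,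
      `|z s u1 - z s0 u1| <= C' * (`|z s u0 - z s0 u0|
          + `|y s u0 - y s0 u0| * `|z s0 u0|) &
      `|y s u1 - y s0 u1 - (s - s0) *: z s0 u1| <=
        C' * (`|y s u0 - y s0 u0 - (s - s0) *: z s0 u0|
          + `|y s u0 - y s0 u0| ^+ 2)].
  apply: filterS3 near_D ni nr => s Ds si /ltW sr.
  have Ks := inK s Ds si sr.
  split; first by apply: (Ks u1 _).1; rewrite in_itv/= u01 lexx.
  have [||||||h1 h2 h3] := CP (y s0) (y s) (z s0) (z s) u0 u1 u01 u1p.
  - by move=> u /K0[].
  - by move=> u /Ks[].
  - by move=> u /K0[iu _]; exact: (phase_ode (lam_geodesic Ds0)).
  - by move=> u /Ks[iu _]; exact: (phase_ode (lam_geodesic Ds)).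
  - by move=> u /K0[iu _]; have [_] := Z_lin Ds0; apply.
  - by move=> u /Ks[iu _]; have [_] := Z_lin Ds; apply.
  by split; [exact: h1|exact: h2|exact: h3].
split.
- by apply: filterS main => s [].
- move=> e' e'0; pose k := 1 + `|z s0 u0|.
  have k0 : 0 < k by rewrite ltr_pwDl.
  have c0 : 0 < C' + 1 by rewrite ltr_wpDl.
  (* The initial remainder and the quadratic error each take half of [e'], after
     division by the constant [C'] of the comparison. *)
  pose e1 := e' / 2 / (C' + 1).
  have e10 : 0 < e1 by rewrite !divr_gt0.
  have hk := ei 1 ltr01; have he := ei e1 e10.
  have hs : \forall s \near within D (nbhs s0), `|s - s0| <= e1 / k ^+ 2.
    apply: cvg_within; apply/nbhs_ballP; exists (e1 / k ^+ 2).
      by rewrite /= divr_gt0// exprn_gt0.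
    by move=> s /=; rewrite -ball_normE /ball_/= distrC => /ltW.
  have hks : \forall s \near within D (nbhs s0),
     `|y s u0 - y s0 u0| <= k * `|s - s0|.
    apply: filterS hk => s; rewrite mul1r => h.
    rewrite -(subrK ((s - s0) *: z s0 u0) (y s u0 - y s0 u0)).
    apply: (le_trans (ler_normD _ _)); rewrite normrZ /k mulrDl mul1r.
    by rewrite [X in _ <= _ + X]mulrC lerD2r.
  apply: filterS3 main he (filterI hks hs) => s [_ [_ _ h3]] h4 [h5 h6].
  apply: (le_trans h3).
  have h7 : `|y s u0 - y s0 u0| ^+ 2 <= e1 * `|s - s0|.
    apply: (@le_trans _ _ ((k * `|s - s0|) ^+ 2)).
      by rewrite ler_pXn2r ?nnegrE// mulr_ge0// ltW.
    rewrite exprMn expr2 [`|s - s0| ^+ 2]expr2 mulrA ler_wpM2r//.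
    by move: h6; rewrite ler_pdivlMr ?exprn_gt0// mulrC expr2.
  have h8 : `|y s u0 - y s0 u0 - (s - s0) *: z s0 u0| + `|y s u0 - y s0 u0| ^+ 2
      <= e' / (C' + 1) * `|s - s0|.
    have -> : e' / (C' + 1) = e1 + e1 by rewrite /e1 -mulrDl -splitr.
    by rewrite mulrDl lerD.
  apply: (le_trans (ler_wpM2l C'0 h8)); rewrite mulrA ler_wpM2r//.
  by rewrite mulrCA ler_piMr ?ltW// ltr_pdivrMr// mul1r ltrDl.
- have c1 := cvg_dist0 li; have c2 := cvg_dist0 cphase.
  have c3 : C' * (`|z s u0 - z s0 u0| + `|y s u0 - y s0 u0| * `|z s0 u0|)
      @[s --> within D (nbhs s0)] --> C' * (0 + 0 * `|z s0 u0|).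
    by apply: cvgMl_tmp; apply: cvgD; [exact: c1|apply: cvgM];
      [exact: c2|exact: cvg_cst].
  rewrite mul0r addr0 mulr0 in c3.
  apply/cvgrPdist_le => e' e'0.
  have /cvgrPdist_le/(_ _ e'0) := c3.
  apply: filterS2 main => s [_ [_ h2 _]].
  rewrite sub0r normrN => h; rewrite distrC.
  by apply: (le_trans h2); apply: le_trans h; exact: ler_norm.
Qed.

Lemma varies (ell : R) : 0 <= ell ->
  (forall i, dom i (lam s0 0) -> varies_in i 0) ->
  forall i, dom i (lam s0 ell) -> varies_in i ell.
Proof.
move=> l0 V0.
apply: (@itv_induction R (fun u => forall i, dom i (lam s0 u) -> varies_in i u)
  0 ell) => //; last by rewrite l0 lexx.
- move=> u /andP[u0 ul] Pu j ju.
  have [d d0 dP] := varies_local ju.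
  pose w := Num.max 0 (u - d / 2).
  have d2 : 0 < d / 2 by rewrite divr_gt0.
  have wu : w < u by rewrite gt_max u0 ltrBlDr ltrDl.
  have wd : `|w - u| < d.
    rewrite distrC gtr0_norm ?subr_gt0// ltrBlDr -ltrBlDl lt_max; apply/orP; right.
    by rewrite ltrD2l ltrN2 ltr_pdivrMr// ltr_pMr// ltr1n.
  have ud : `|u - u| < d by rewrite subrr normr0.
  have [jw _ V] := dP w u wd ud (ltW wu).
  by apply: V; apply: Pu => //; rewrite le_max lexx.
- move=> u /andP[u0 ul] Pu.
  have [i iu] := dom_cover (lam s0 u).
  have [d d0 dP] := varies_local iu.
  exists d => // v /andP[uv vd] j jv.
  have ud : `|u - u| < d by rewrite subrr normr0.
  have vd' : `|v - u| < d by rewrite ger0_norm ?subr_ge0// ltrBlDl.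
  have [_ iv V] := dP u v ud vd' uv.
  apply: (varies_change iv jv); apply: V; apply: Pu => //.
  by rewrite u0 lexx.
Qed.

End Propagation.

(** * The integral inequality *)

Section Integral.
Context {R : realType}.
Local Notation mu := (@lebesgue_measure R).

(** The integral of a nonnegative function is a supremum over the simple
functions below it. *)
Lemma ge0_le_integral_nonmeasurable (D : set R) (f h : R -> R) :
  (forall x, D x -> 0 <= f x) -> (forall x, D x -> f x <= h x) ->
  (\int[mu]_(x in D) (f x)%:E <= \int[mu]_(x in D) (h x)%:E)%E.
Proof.
move=> f0 fh.
have f0' x : D x -> (0 <= (f x)%:E)%E by move=> Dx; rewrite lee_fin f0.
have h0' x : D x -> (0 <= (h x)%:E)%E.
  by move=> Dx; rewrite lee_fin (le_trans (f0 _ Dx))// fh.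
rewrite [X in (X <= _)%E]ge0_integralE// [X in (_ <= X)%E]ge0_integralE//.
apply: ereal_sup_le => _ [k /= kf <-]; exists k => //= x.
apply: (le_trans (kf x)); rewrite /patch; case: ifPn => // /set_mem Dx.
by rewrite lee_fin fh.
Qed.

Lemma le_Rintegral_nonmeasurable (D : set R) (f h : R -> R) :
  (forall x, D x -> 0 <= f x <= h x) -> mu.-integrable D (EFin \o h) ->
  measurable D -> \int[mu]_(x in D) f x <= \int[mu]_(x in D) h x.
Proof.
move=> fh ih mD.
have le : (\int[mu]_(x in D) (f x)%:E <= \int[mu]_(x in D) (h x)%:E)%E.
  by apply: ge0_le_integral_nonmeasurable => x /fh/andP[].
have fin_h : (\int[mu]_(x in D) (h x)%:E)%E \is a fin_num.
  exact: integrable_fin_num.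
apply: fine_le => //.
have f0 : (0 <= \int[mu]_(x in D) (f x)%:E)%E.
  by apply: integral_ge0 => x /fh/andP[]; rewrite lee_fin.
rewrite ge0_fin_numE//; apply: (le_lt_trans le).
by rewrite ltey_eq fin_h.
Qed.

(** The tangent line of [y |-> sqrt (1 + y ^+ 2)] at [m], taken at [sqrt x]; this
is the Cauchy-Schwarz inequality for [(1, m)] and [(1, sqrt x)]. *)
Lemma tangent_sqrt (m x : R) : 0 <= x ->
  (1 + m * Num.sqrt x) / Num.sqrt (1 + m ^+ 2) <= Num.sqrt (1 + x).
Proof.
move=> x0; have m0 : 0 <= m ^+ 2 by exact: sqr_ge0.
have q0 : 0 < Num.sqrt (1 + m ^+ 2) by rewrite sqrtr_gt0 ltr_pwDl.
rewrite ler_pdivrMr// -sqrtrM; last by rewrite addr_ge0.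
apply: (le_trans (ler_norm _)); rewrite -sqrtr_sqr ler_wsqrtr//.
have E := sqr_sqrtr x0; have h : 0 <= (Num.sqrt x - m) ^+ 2 by exact: sqr_ge0.
by move: h E; set s := Num.sqrt x => h <-; nra.
Qed.

(** Jensen's inequality, obtained by integrating [tangent_sqrt] at the mean value
[m] of [p].  The equation for [v] leaves out the end points: [v] will be a speed,
and speeds are two-sided derivatives. *)
Lemma integral_sqrt_lower_bound (L : R) (N v p : R -> R) : 0 < L ->
  {within `[0, L], continuous N} ->
  (forall s, 0 <= s <= L -> 1 <= N s) ->
  (forall s, 0 < s < L -> v s = Num.sqrt (N s)) ->
  (forall s, 0 <= s <= L -> 0 <= p s <= Num.sqrt (N s - 1)) ->
  \int[mu]_(s in `[0, L]) v s - L >=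
  L * (Num.sqrt (1 + (L^-1 * \int[mu]_(s in `[0, L]) p s) ^+ 2) - 1).
Proof.
move=> L0 cN N1 vN pN.
have mD : measurable (`[0, L]%classic : set R) by exact: measurable_itv.
have cpt : compact (`[0, L]%classic : set R) by exact: segment_compact.
have csqrt (a : R) : {within `[0, L], continuous (fun s => Num.sqrt (N s - a))}.
  move=> s; apply: (@continuous_comp (subspace `[0, L]) R R (fun s => N s - a)
    (fun x => Num.sqrt x)).
    by apply: cvgB; [exact: cN|exact: cvg_cst].
  exact: sqrt_continuous.
have ih : mu.-integrable `[0, L] (EFin \o (fun s => Num.sqrt (N s - 0))).
  exact: continuous_compact_integrable.
have if1 : mu.-integrable `[0, L] (EFin \o (fun s => Num.sqrt (N s - 1))).
  exact: continuous_compact_integrable.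
have muL : fine (mu `[0, L]) = L.
  by rewrite lebesgue_measure_itv/= lte_fin L0 -EFinD subr0.
have Ev : \int[mu]_(s in `[0, L]) v s =
    \int[mu]_(s in `[0, L]) Num.sqrt (N s - 0).
  rewrite /Rintegral; congr fine.
  have mh : measurable_fun `]0, L[ (fun s => Num.sqrt (N s - 0)).
    apply: (@measurable_funS _ _ _ _ `[0, L]) => //; first exact: subset_itv_oo_cc.
    by have /integrableP[/measurable_EFinP] := ih.
  have E : {in `]0, L[, (fun s => Num.sqrt (N s - 0)) =1 v}.
    by move=> s; rewrite in_itv/= subr0 => /vN.
  apply/esym; apply: eq_integral_itv_bounded => //.
  apply: eq_measurable_fun mh => s; rewrite inE => /E; exact.
rewrite Ev.
set I := \int[mu]_(s in `[0, L]) p s.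
pose m := L^-1 * I.
have I0 : 0 <= I by apply: Rintegral_ge0 => s /=; rewrite in_itv/= => /pN/andP[].
have m0 : 0 <= m by rewrite mulr_ge0// invr_ge0 ltW.
have If : I <= \int[mu]_(s in `[0, L]) Num.sqrt (N s - 1).
  by apply: le_Rintegral_nonmeasurable => // s /=; rewrite in_itv/= => /pN.
set q := Num.sqrt (1 + m ^+ 2).
have q0 : 0 < q by rewrite sqrtr_gt0 ltr_pwDl// sqr_ge0.
have qq : q ^+ 2 = 1 + m ^+ 2 by rewrite sqr_sqrtr// addr_ge0// sqr_ge0.
have ic : mu.-integrable `[0, L] (EFin \o (fun=> q^-1)).
  by apply: continuous_compact_integrable => // s; exact: cvg_cst.
have imf : mu.-integrable `[0, L] (EFin \o (fun s => (m / q) * Num.sqrt (N s - 1))).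
  apply: continuous_compact_integrable => // s.
  by apply: cvgM; [exact: cvg_cst|exact: csqrt].
have lb : \int[mu]_(s in `[0, L]) (q^-1 + (m / q) * Num.sqrt (N s - 1)) <=
    \int[mu]_(s in `[0, L]) Num.sqrt (N s - 0).
  apply: le_Rintegral => //.
    apply: continuous_compact_integrable => // s.
    by apply: cvgD; [exact: cvg_cst|apply: cvgM; [exact: cvg_cst|exact: csqrt]].
  move=> s /=; rewrite in_itv/= => /N1 N1s.
  have := @tangent_sqrt m (N s - 1); rewrite subr_ge0 => /(_ N1s).
  by rewrite -/q (addrC 1 (N s - 1)) subrK mulrDl mul1r subr0 mulrAC.
rewrite RintegralD// RintegralZl// Rintegral_cst// muL in lb.
rewrite -/m -/q mulrBr mulr1 lerD2r; apply: le_trans lb.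
have h : m / q * I <= m / q * \int[mu]_(s in `[0, L]) Num.sqrt (N s - 1).
  by rewrite ler_wpM2l// divr_ge0// ltW.
apply: le_trans (_ : q^-1 * L + m / q * I <= _); last by rewrite lerD2l.
have -> : I = L * m by rewrite /m mulrA divff ?mul1r// gt_eqF.
have -> : q^-1 * L + m / q * (L * m) = L * (1 + m ^+ 2) / q.
  by field; rewrite gt_eqF.
by rewrite -qq expr2 mulrA mulfK// gt_eqF.
Qed.

End Integral.

(** * Poles of a tractrix *)

Section InitialCondition.
Context {R : realType} {n : nat} {M : manifold R n} (g : riemannian_metric M).
Implicit Types (i : chart M) (gamma c : R -> M) (Z J : vfield M).

Lemma gamZZ i (x u v : 'rV[R]_n) (a b : R) :
  gam g i x (a *: u) (b *: v) = (a * b) *: gam g i x u v.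
Proof.
apply/rowP => d; rewrite !mxE mulr_sumr; apply: eq_bigr => k _.
by rewrite mulr_sumr; apply: eq_bigr => l _; rewrite !mxE; ring.
Qed.

Lemma gam0r i (x u : 'rV[R]_n) : gam g i x u 0 = 0.
Proof. by have := gamZZ i x u 0 1 0; rewrite scaler0 mulr0 scale0r scale1r. Qed.

(** The Christoffel terms in the covariant derivatives of [J] and of [gamma']
cancel the one of the geodesic equation, because [eps ^+ 2 = 1]. *)
Lemma lift_start (eps s : R) gamma c J i : eps ^+ 2 = 1 ->
  geodesic g c -> c 0 = gamma s -> dom i (gamma s) ->
  velocity c i 0 = eps *: velocity gamma i s ->
  smooth_vfield_along c J -> J i 0 = 0 ->
  covD g c J i 0 = eps *: acceleration g gamma i s ->
  lift (fun i u => eps *: velocity c i u + J i u) i 0 =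
    row_mx (velocity gamma i s) (eps *: derive1 (velocity gamma i) s).
Proof.
move=> e2 gc c0 di vc vJ J0 dJ.
have sc : smooth_curve setT c by case: gc.
have ic : dom i (c 0) by rewrite c0.
rewrite (lift_comb _ (velocity_vfield sc) vJ ic) /lift J0.
rewrite (geodesic_velocity gc ic) c0 vc gamZZ -expr2 e2 scale1r.
have -> : derive1 (J i) 0 = eps *: acceleration g gamma i s.
  rewrite -dJ; apply/esym.
  have -> : covD g c J i 0 = derive1 (J i) 0 +
    gam g i (chart_map i (c 0)) (velocity c i 0) (J i 0) by [].
  by rewrite J0 gam0r addr0.
have -> : acceleration g gamma i s = derive1 (velocity gamma i) s +
  gam g i (chart_map i (gamma s)) (velocity gamma i s) (velocity gamma i s) by [].
rewrite scale_row_mx add_row_mx addr0 scalerA -expr2 e2 scale1r.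
by rewrite scalerDr scalerN addrC addrK.
Qed.

End InitialCondition.

Section Tractrix.
Context {R : realType} {n : nat} {M : manifold R n} (g : riemannian_metric M).
Variables (eps ell a b L : R) (eta gamma : R -> M) (lam : R -> R -> M).
Variables (t : R -> R) (J : R -> vfield M).
Hypothesis heps : eps = 1 \/ eps = -1.
Hypothesis hell : 0 < ell.
Hypothesis hL : 0 < L.
Hypothesis htr : tractrix g eps ell a b eta L gamma lam t.
Hypothesis hJ : pole_jacobi g eps L gamma lam J.

Let D : set R := [set s | 0 <= s <= L].
(** The variation field of the poles: its tangential part is constant, because
the poles and [gamma] have unit speed, and its normal part is the Jacobi field. *)
Let Z (s : R) : vfield M := fun i u => eps *: velocity (lam s) i u + J s i u.

Lemma eps2 : eps ^+ 2 = 1.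
Proof. by case: heps => ->; rewrite ?sqrrN expr1n. Qed.

Lemma pole_geodesic s : D s -> geodesic g (lam s).
Proof. by case: htr => _ _ /(_ s) h /h[[]]. Qed.

Lemma pole_speed s : D s -> forall u, speed g (lam s) u = 1.
Proof. by case: htr => _ _ /(_ s) h /h[[]]. Qed.

Lemma pole_variation_linearized s : D s -> linearized g (lam s) (Z s).
Proof.
move=> Ds; have gc := pole_geodesic Ds; have [sc _] := gc.
apply: (linearized_comb _ sc (velocity_linearized gc)).
by apply: jacobi_linearized gc _; have [] := hJ Ds.
Qed.

Lemma pole_lift_start s i : D s -> dom i (gamma s) ->
  lift (Z s) i 0 = row_mx (velocity gamma i s) (eps *: derive1 (velocity gamma i) s).
Proof.
move=> Ds di; case: htr => _ _ /(_ s Ds)[_ l0 lv _ _].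
have [[vJ _] _ J0 dJ] := hJ Ds.
apply: (lift_start (g := g)) => //; first exact: eps2.
- exact: pole_geodesic.
- exact: lv.
- exact: J0.
- exact: dJ.
Qed.

(** At the foot of the pole, differentiability in [s] is that of [gamma] and of
its velocity. *)
Lemma pole_varies_start s0 i : D s0 -> dom i (lam s0 0) ->
  varies_in D s0 lam Z i 0.
Proof.
move=> Ds0; case: htr => -[A [LA sA]] _ H.
have l0 s : D s -> lam s 0 = gamma s by move=> /H[].
have phase0 s : D s -> dom i (gamma s) ->
    phase (lam s) i 0 = row_mx (chart_map i (gamma s)) (eps *: velocity gamma i s).
  by move=> Ds di; rewrite /phase (l0 _ Ds); have [_ _ /(_ i di) -> _ _] := H s Ds.
rewrite (l0 _ Ds0) => di0.
have As0 : A s0 by apply: LA; rewrite /= in_itv.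
have nO := open_nbhs_nbhs (conj (curve_dom_open (i := i) sA) (conj As0 di0)).
have nD : \forall s \near within D (nbhs s0), D s /\ dom i (gamma s).
  by rewrite near_withinE; apply: filterS nO => s [_ ds] Ds.
have hx := chart_is_derive sA As0 di0.
have hv := velocity_is_derive sA As0 di0.
split.
- by apply: filterS nD => s [Ds ds]; rewrite l0.
- rewrite (pole_lift_start Ds0 di0).
  apply: (@expands_near_eq _ _ _ _ (fun s =>
      row_mx (chart_map i (gamma s)) (eps *: velocity gamma i s))).
  + by rewrite phase0.
  + by apply: filterS nD => s [Ds ds]; rewrite phase0.
  by apply: is_derive_expands; apply: (is_derive_row_mx hx); exact: is_deriveZ.
- have [_ _ /(_ i) sg] := sA.
  have h3 := smooth_is_derive (smooth_derive1 (smooth_derive1 sg)) (conj As0 di0).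
  have h4 : is_derive s0 1 (fun s => row_mx (velocity gamma i s)
      (eps *: derive1 (velocity gamma i) s)) _ :=
    is_derive_row_mx hv (is_deriveZ eps h3).
  rewrite (pole_lift_start Ds0 di0).
  have c := expands_cvg (is_derive_expands D h4).
  apply: (cvg_trans _ c); apply: near_eq_cvg.
  by apply: filterS nD => s [Ds ds]; rewrite pole_lift_start.
Qed.

Lemma pole_varies s0 i : D s0 -> dom i (lam s0 ell) ->
  varies_in D s0 lam Z i ell.
Proof.
move=> Ds0; apply: (varies Ds0 pole_geodesic pole_speed pole_variation_linearized).
  exact: ltW.
by move=> j; exact: pole_varies_start.
Qed.

(** The square of the speed of the tractor. *)
Let N (s : R) : R := 1 + inner g (lam s) (J s) (J s) ell.

Lemma inner_ge0 (c : R -> M) (X : vfield M) u : 0 <= inner g c X X u.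
Proof.
rewrite /inner; set i := chart_at _.
have iu : dom i (c u) by rewrite /i /chart_at; case: cid.
have [->|v0] := eqVneq (X i u) 0; first by rewrite !mul0mx mxE.
by apply: ltW; exact: gram_posdef.
Qed.

(** Pythagoras' theorem: [J] is orthogonal to the pole, which has unit speed. *)
Lemma quad_variation s i : D s -> dom i (lam s ell) ->
  quad g i (chart_map i (lam s ell)) (Z s i ell) = N s.
Proof.
move=> Ds iu; have gc := pole_geodesic Ds; have [sc _] := gc.
have [[vJ _] JT _ _] := hJ Ds.
have hT j : dom j (lam s ell) -> velocity (lam s) j ell =
    velocity (lam s) i ell *m change_mx i j (lam s ell).
  by move=> ju; exact: (velocity_change sc).
have hK j : dom j (lam s ell) -> J s j ell =
    J s i ell *m change_mx i j (lam s ell).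
  by move=> ju; exact: vJ.1.
have := JT ell; rewrite (innerE g iu hK hT) => ortho.
rewrite /N (innerE g iu hK hK).
have := speed_quad g sc iu; rewrite (pole_speed Ds) expr1n /quad /Z.
have sym := gram_sym g iu.
move: ortho sym; set G := g i _; set T := velocity _ i ell; set K := J s i ell.
move=> ortho sym tt.
have ortho' : (T *m G *m K^T) 0 0 = 0.
  have -> : T *m G *m K^T = (K *m G *m T^T)^T.
    by rewrite !trmx_mul trmxK sym mulmxA.
  by rewrite [LHS]mxE.
rewrite linearD linearZ/= !mulmxDl !mulmxDr -!scalemxAl -!scalemxAr.
have mE (A B C E : 'M[R]_1) : (A + B + (C + E)) 0 0 = A 0 0 + B 0 0 + (C 0 0 + E 0 0).
  by rewrite !mxE.
have sE (c : R) (A : 'M[R]_1) : (c *: A) 0 0 = c * A 0 0 by rewrite mxE.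
by rewrite mE !sE ortho ortho' !mulr0 addr0 add0r tt mulr1 -expr2 eps2.
Qed.

Lemma N_continuous : {within `[0, L], continuous N}.
Proof.
apply/subspace_continuousP => s0 /=; rewrite in_itv/= => Ds0.
have [i iu] := dom_cover (lam s0 ell).
have [ni ei li] := pole_varies Ds0 iu.
have cp := expands_cvg ei.
have c1 : chart_map i (lam s ell) @[s --> within D (nbhs s0)] -->
    chart_map i (lam s0 ell).
  have := cvg_comp _ _ cp (@lsubmx_continuous _ _ _).
  rewrite {2}/phase row_mxKl; apply: cvg_trans; apply: near_eq_cvg.
  by apply: nearW => s; rewrite /= /phase row_mxKl.
have c2 : Z s i ell @[s --> within D (nbhs s0)] --> Z s0 i ell.
  have := cvg_comp _ _ li (@lsubmx_continuous _ _ _).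
  rewrite {2}/lift row_mxKl; apply: cvg_trans; apply: near_eq_cvg.
  by apply: nearW => s; rewrite /= /lift row_mxKl.
have E : within `[0, L] (nbhs s0) = within D (nbhs s0).
  congr within; apply/seteqP; split => s; rewrite /D /= in_itv//.
rewrite E.
have c3 := @cvg_quad _ _ _ g i _ (within D (nbhs s0)) _ _ _ _ _ (range_map iu) c1 c2.
rewrite (quad_variation Ds0 iu) in c3.
apply: (cvg_trans _ (c3 _)); apply: near_eq_cvg.
have nD : \forall s \near within D (nbhs s0), D s.
  by rewrite near_withinE; apply: nearW.
by apply: filterS2 nD ni => s Ds di; rewrite quad_variation.
Qed.

(** The tractor consists of the end points of the poles, so its velocity is their
variation field at [ell]. *)
Lemma tractor_speed s0 : 0 < s0 < L ->
  speed g (fun s => eta (t s)) s0 = Num.sqrt (N s0).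
Proof.
move=> /andP[s00 s0L].
have Ds0 : D s0 by rewrite /D/= !ltW.
have El s : D s -> lam s ell = eta (t s) by case: htr => _ _ H /H[].
have nD : nbhs s0 D.
  have n1 : \forall s \near s0, s \in `]0, L[%R.
    by apply: near_in_itvoo; rewrite in_itv/= s00 s0L.
  by apply: filterS n1 => s; rewrite in_itv/= => /andP[h1 h2]; rewrite /D/= !ltW.
rewrite /speed /field_norm /inner -(El _ Ds0).
set i := chart_at _.
have iu : dom i (lam s0 ell) by rewrite /i /chart_at; case: cid.
have [_ ei _] := pole_varies Ds0 iu.
have hd := expands_is_derive nD ei.
have hl : is_derive s0 1 (fun s => chart_map i (lam s ell)) (Z s0 i ell).
  apply: is_derive_mx => z k.
  have E : (fun s => phase (lam s) i ell z (lshift n k)) =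
      (fun s => chart_map i (lam s ell) z k).
    by apply/funext => s; rewrite /phase row_mxEl.
  by have := is_derive_mxE z (lshift n k) hd; rewrite E /lift row_mxEl.
have vE : velocity (fun s => eta (t s)) i s0 = Z s0 i ell.
  rewrite /velocity derive1E.
  have h : is_derive s0 1 (chart_map i \o (fun s => eta (t s))) (Z s0 i ell).
    apply: near_eq_is_derive hl.
    by apply: filterS nD => s Ds; rewrite /= El.
  by have [_ ->] := h.
by rewrite vE -(quad_variation Ds0 iu).
Qed.

Lemma gamma_length : curve_length g 0 L gamma = L.
Proof.
rewrite /curve_length (@eq_Rintegral _ _ _ _ _ (fun=> 1)); last first.
  move=> s; rewrite inE/= in_itv/= => Ds.
  by case: htr => _ /(_ s Ds) -> _.
rewrite Rintegral_cst; last exact: measurable_itv.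
have muL : fine (lebesgue_measure (`[0, L]%classic : set R)) = L.
  by rewrite lebesgue_measure_itv/= lte_fin hL -EFinD subr0.
by rewrite mul1r; exact: muL.
Qed.

Lemma curvature_jacobi_bound s :
  0 <= geodesic_curvature g gamma s * normalized_jacobi g gamma lam J s ell
    <= Num.sqrt (N s - 1).
Proof.
rewrite /normalized_jacobi.
have -> : N s - 1 = inner g (lam s) (J s) (J s) ell by rewrite /N addrAC subrr add0r.
rewrite -/(field_norm g (lam s) (J s) ell).
set f := field_norm _ _ _ _; have f0 : 0 <= f by exact: sqrtr_ge0.
have [->|k0] := eqVneq (geodesic_curvature g gamma s) 0; first by rewrite mul0r lexx.
by rewrite mulrCA mulfV// mulr1 f0 lexx.
Qed.

Lemma tractor_length_bound :
  L * (Num.sqrt (1 + (L^-1 * \int[lebesgue_measure]_(s in `[0, L])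
         (geodesic_curvature g gamma s * normalized_jacobi g gamma lam J s ell))
       ^+ 2) - 1) <= curve_length g 0 L (fun s => eta (t s)) - L.
Proof.
apply: (integral_sqrt_lower_bound hL N_continuous).
- by move=> s _; rewrite /N lerDl inner_ge0.
- exact: tractor_speed.
- by move=> s _; exact: curvature_jacobi_bound.
Qed.

End Tractrix.

Unset Implicit Arguments.

Theorem corollary6p2 (R : realType) (n : nat) (M : manifold R n)
    (g : riemannian_metric M) (hM : riemannian_complete g)
    (eps ell : R) (heps : eps = 1 \/ eps = -1) (hell : 0 < ell)
    (a b : R) (eta : R -> M) (heta : tractor_curve g a b eta)
    (L : R) (hL : 0 < L) (gamma : R -> M) (lam : R -> R -> M) (t : R -> R)
    (htractrix : tractrix g eps ell a b eta L gamma lam t)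
    (J : R -> vfield M) (hJ : pole_jacobi g eps L gamma lam J) :
  curve_length g 0 L (fun s => eta (t s)) - curve_length g 0 L gamma >=
  curve_length g 0 L gamma *
    (Num.sqrt (1 + ((curve_length g 0 L gamma)^-1 *
       \int[lebesgue_measure]_(s in `[0, curve_length g 0 L gamma])
         (geodesic_curvature g gamma s * normalized_jacobi g gamma lam J s ell))
       ^+ 2) - 1).
Proof.
rewrite (gamma_length hL htractrix).
exact: (tractor_length_bound heps hell hL htractrix hJ).
Qed.
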